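(* Let $n_1,n_2,\ldots$ be integers with $n_i\ge 1$ for all $i\ge 1$, let $\theta>0$, let $(\tilde\Pi_t)_{t\ge 0}$ be the multiset Chinese restaurant process with parameter $\theta$ for this sequence, and let $K_t=|\tilde\Pi_t|$ be the number of cycles of $\tilde\Pi_t$. (i) If $\theta=1$ and there is an integer $n\ge 1$ with $n_i=n$ for all $i\ge 1$, then as $t\to\infty$ $$\mathbb{E}(K_t)\sim\log t,\qquad \mathrm{Var}(K_t)\sim\log t.$$ (ii) For general $\theta>0$, suppose that $n_i=O(1)$, i.e. the sequence $(n_i)_{i\ge1}$ is bounded. Then $$\mathbb{E}(K_t)\asymp\log t,\qquad \mathrm{Var}(K_t)\asymp\log t,$$ and, as $t\to\infty$, $$K_t\sim\mathbb{E}(K_t)\ \text{ almost surely},\qquad \frac{K_t-\mathbb{E}(K_t)}{\sqrt{\mathrm{Var}(K_t)}}\stackrel{d}{\to}\mathrm{N}(0,1).$$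
   Context: **Asymptotic notation.** $a_t\asymp b_t$ means that there are constants $C_1,C_2>0$ with $C_1b_t\le a_t\le C_2b_t$ (for all sufficiently large $t$); $a_t\sim b_t$ means $\lim_{t\to\infty}a_t/b_t=1$; $a_t=O(b_t)$ means $a_t\le Cb_t$ for some constant $C>0$; $\stackrel{d}{\to}$ is convergence in distribution and $\mathrm{N}(0,1)$ is the standard normal distribution. **Multiset permutations.** For $t\ge 1$, $M(n_1,\ldots,n_t)$ is the multiset containing $n_i$ copies of $i$ for each $i\in[t]=\{1,\ldots,t\}$; for $t=0$ it is empty. Elements are ordered as integers. Put $N_t=n_1+\cdots+n_t$, $N_0=0$. A permutation of a multiset is an arrangement of its elements in a row; $S(n_1,\ldots,n_t)$ is the set of permutations of $M(n_1,\ldots,n_t)$ (for $t=0$ it consists of the empty permutation only). In two-line notation, a permutation has as its top line the elements of the multiset in nondecreasing order and as its bottom line the arrangement. **Intercalation product.** For permutations $\pi_1,\pi_2$ of two multisets, $\pi_1\top\pi_2$ is the permutation of the multiset union (multiplicities added) obtained by juxtaposing the two-line notations of $\pi_1$ and $\pi_2$ (with $\pi_1$ on the left) and stably sorting the columns into nondecreasing order of the top line (columns with equal top entries keep their left-to-right order). **Cycles.** For possibly repeated elements $x_1,\ldots,x_m$, the cycle $(x_1\,x_2\ldots x_m)$ is the multiset permutation obtained by stably sorting by top entry the columns of the two-line array with top line $x_1,x_2,\ldots,x_m$ and bottom line $x_2,x_3,\ldots,x_m,x_1$. **Cycle factorisation (known theorem of Knuth).** Every nonempty multiset permutation $\pi$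 has a unique representation $$\pi=(x_{1,1}\ldots x_{1,m_1}\,y_1)\top(x_{2,1}\ldots x_{2,m_2}\,y_2)\top\cdots\top(x_{\tau,1}\ldots x_{\tau,m_\tau}\,y_\tau),\qquad \tau\ge 1,\ m_i\ge 0,$$ with $y_1\le y_2\le\cdots\le y_\tau$ and $y_i<x_{i,j}$ for all $1\le j\le m_i$, $1\le i\le\tau$. The number of cycles of $\pi$ is $|\pi|=\tau$ (and $0$ for the empty permutation). **The multiset Chinese restaurant process (CRP).** For $\theta>0$ and $t\ge 1$ let $$F_t(\theta)=\sum_{k=0}^{n_t}\binom{N_{t-1}-1+n_t-k}{n_t-k}\theta^{k},$$ with the convention $\binom{-1}{0}=1$ and $\binom{-1}{k}=0$ for $k\ge 1$. The process is a Markov chain with $\tilde\Pi_0$ the empty permutation and $\tilde\Pi_t\in S(n_1,\ldots,n_t)$. Given $\tilde\Pi_{t-1}$, written in its unique cycle factorisation, step $t$ consists of choosing $k_t\in\{0,1,\ldots,n_t\}$, placing $k_t$ copies of $t$ in $k_t$ new singleton cycles $(t)$ appended at the right end of the factorisation, and inserting the remaining $n_t-k_t$ copies of $t$ inside the existing cycles, each immediately to the left of one of the $N_{t-1}$ elements (the $x_{i,j}$'s and $y_i$'s) of the factorisation of $\tilde\Pi_{t-1}$. Several copies may be inserted to the left of the same element, so an insertion is specified by a vector of $N_{t-1}$ nonnegative integers summing to $n_t-k_t$, and there are $\binom{N_{t-1}-1+n_t-k_t}{n_t-k_t}$ of them. Each specific choice of $k_t$ together with a specific insertion of the other $n_t-k_t$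 copies is made with probability $\theta^{k_t}/F_t(\theta)$. The result is the cycle factorisation of $\tilde\Pi_t$. Consequently $K_t=\sum_{s=1}^t X_s$, where $X_s$ is the number of new cycles created at step $s$; the $X_s$ are independent with $$\mathbb{P}(X_s=k)=\frac{\theta^{k}}{F_s(\theta)}\binom{N_{s-1}-1+n_s-k}{n_s-k},\qquad k\in\{0,1,\ldots,n_s\}.$$ *)

(* Defs.v *)
From HB Require Import structures.
From mathcomp Require Import all_boot all_order all_algebra.
From mathcomp Require Import all_classical all_reals all_analysis.
Set Implicit Arguments.
Unset Strict Implicit.
Unset Printing Implicit Defensive.
Import Order.TTheory GRing.Theory Num.Theory.
Import numFieldNormedType.Exports.
Local Open Scope classical_set_scope.
Local Open Scope ring_scope.

(* The sequence n_1, n_2, ... is a function nat -> nat whose value at 0 is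
   never used. *)

Definition mset (n : nat -> nat) (t : nat) : seq nat :=
  flatten [seq nseq (n i) i | i <- iota 1 t].

Definition msize (n : nat -> nat) (t : nat) : nat :=
  (\sum_(1 <= i < t.+1) n i)%N.

(* A multiset permutation is given by the bottom line of its two-line notation,
   the top line being the same letters in nondecreasing order. *)
Definition is_mperm (n : nat -> nat) (t : nat) (w : seq nat) : bool :=
  perm_eq w (mset n t).

Definition two_line (w : seq nat) : seq (nat * nat) := zip (sort leq w) w.

(* path.sort is a stable sort. *)
Definition of_columns (c : seq (nat * nat)) : seq nat :=
  unzip2 (sort (fun p q => p.1 <= q.1)%N c).

Definition intercalation (w1 w2 : seq nat) : seq nat :=
  of_columns (two_line w1 ++ two_line w2).

Definition cycle_perm (x : seq nat) : seq nat := of_columns (zip x (rot 1 x)).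

(* c = (x_1 ... x_m y) with y < x_j for all j; belast x s is x :: s without its
   last letter. *)
Definition normal_cycle (c : seq nat) : bool :=
  if c is x :: s then all (fun z => last x s < z)%N (belast x s) else false.

Definition is_cycle_factorisation (w : seq nat) (f : seq (seq nat)) : bool :=
  [&& all normal_cycle f,
      sorted leq [seq last 0%N c | c <- f]
    & w == foldr intercalation [::] [seq cycle_perm c | c <- f]].

(* By Knuth's theorem, each multiset permutation has exactly one factorisation;
   the default value [::] of xget is therefore never used. *)
Definition cycle_factorisation (w : seq nat) : seq (seq nat) :=
  xget [::] [set f | is_cycle_factorisation w f].

Definition num_cycles (w : seq nat) : nat := size (cycle_factorisation w).

(* Puts v_i copies of t immediately to the left of the i-th letter of c. *)
Definition insert_copies (t : nat) (v c : seq nat) : seq nat :=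
  flatten [seq rcons (nseq p.1 t) p.2 | p <- zip v c].

(* The elements of f are numbered from left to right, cycle after cycle; reshape
   cuts the insertion vector v into the parts that concern each cycle. *)
Definition crp_insert (t k : nat) (v : seq nat) (f : seq (seq nat)) :
    seq (seq nat) :=
  [seq insert_copies t p.1 p.2 | p <- zip (reshape (shape f) v) f]
    ++ nseq k [:: t].

(* The new permutation is the intercalation product of the cycles obtained. *)
Definition crp_step (t k : nat) (v : seq nat) (w : seq nat) : seq nat :=
  foldr intercalation [::]
    [seq cycle_perm c | c <- crp_insert t k v (cycle_factorisation w)].

(* The truncated predecessor gives 'C(-1, 0) = 1 and 'C(j - 1, j) = 0 for
   0 < j when msize n t.-1 = 0, i.e. when t = 1. *)
Definition crp_F (R : realType) (n : nat -> nat) (theta : R) (t : nat) : R :=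
  \sum_(k < (n t).+1)
    'C((msize n t.-1 + (n t - k)).-1, n t - k)%:R * theta ^+ k.

(* Probability to go from w at time t - 1 to w' at time t: the total weight of
   the choices (k, v) that lead from w to w', where k is the number of new
   singleton cycles and v is the insertion vector of the n_t - k other copies
   of t. *)
Definition crp_transition (R : realType) (n : nat -> nat) (theta : R) (t : nat)
    (w w' : seq nat) : R :=
  \sum_(k < (n t).+1)
    \sum_(v : (msize n t.-1).-tuple 'I_(n t).+1
            | (\sum_(i <- v) i == n t - k)%N
              && (crp_step t k [seq val i | i <- v] w == w'))
       theta ^+ k / crp_F n theta t.

(* The event that the process follows w_0, ..., w_t up to time t. *)
Definition path_event (T : Type) (Pi : nat -> T -> seq nat)
    (w : nat -> seq nat) (t : nat) : set T :=
  [set x | forall s, (s <= t)%N -> Pi s x = w s].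

(* crp_markov is the Markov property with its transition probabilities, in
   product form so that no conditioning on null events occurs. *)
Record is_multiset_crp (R : realType) (d : measure_display)
    (T : measurableType d) (P : probability T R) (n : nat -> nat) (theta : R)
    (Pi : nat -> T -> seq nat) : Prop := IsMultisetCRP {
  crp_measurable : forall t w, measurable (Pi t @^-1` [set w]);
  crp_mperm : forall t x, is_mperm n t (Pi t x);
  crp_init : forall x, Pi 0%N x = [::];
  crp_markov : forall (t : nat) (w : nat -> seq nat),
    P (path_event Pi w t.+1) =
    (P (path_event Pi w t)
       * (crp_transition n theta t.+1 (w t) (w t.+1))%:E)%E }.

Definition crp_K (R : realType) (T : Type) (Pi : nat -> T -> seq nat) (t : nat)
    (x : T) : R := (num_cycles (Pi t x))%:R.

(* Only applied to the bounded variables K_t (at most msize n t), so that fine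
   loses nothing. *)
Definition mean (R : realType) (d : measure_display) (T : measurableType d)
    (P : probability T R) (X : T -> R) : R := fine 'E_P[X].

Definition var (R : realType) (d : measure_display) (T : measurableType d)
    (P : probability T R) (X : T -> R) : R := fine 'V_P[X].

Definition asym_equiv (R : realType) (a b : nat -> R) : Prop :=
  a t / b t @[t --> \oo] --> (1 : R).

Definition asym_order (R : realType) (a b : nat -> R) : Prop :=
  exists C1 C2 : R, [/\ 0 < C1, 0 < C2 &
    \forall t \near \oo, C1 * b t <= a t <= C2 * b t].

Definition cvg_in_distribution (R : realType) (d : measure_display)
    (T : measurableType d) (P : probability T R) (X : nat -> T -> R)
    (mu : set R -> \bar R) : Prop :=
  forall x : R, {for x, continuous (fun y : R => mu [set` `]-oo, y]])} ->
    P [set z | X t z <= x] @[t --> \oo] --> mu [set` `]-oo, x]].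

(* Main.v *)
(* K_t is a sum of independent variables X_1, ..., X_t, and only two facts about
   the process are needed: the law of each K_t and the almost sure monotonicity
   of t |-> K_t.  Both follow from the uniqueness of the cycle factorisation: in
   the two-line notation, the bottom letters below each top letter are consumed
   in order, so each cycle is recovered by walking from its smallest letter until
   that letter comes back; hence an insertion step with k new cycles raises the
   number of cycles by exactly k.

   The weights of X_t satisfy P(X_t = k + 1) = P(X_t = k) O(1/t), so E(X_t) and
   Var(X_t) are both theta n_t / N_(t-1) + O(1/t^2), and summing gives (i) and the
   orders of magnitude in (ii).  The law of large numbers follows from
   Chebyshev's inequality and Borel-Cantelli along the first times when E(K_t)
   exceeds a square, and monotonicity in between.  For the central limit theorem,
   Lindeberg's replacement is run with the test functions Phi((a - y) / sqrt S):
   they solve the heat equation exactly, so no convolution of Gaussians occurs;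
   Phi((a - y) / eps) then sandwiches the indicator of y <= a. *)

Require Import Defs.
From HB Require Import structures.
From mathcomp Require Import all_boot all_order all_algebra.
From mathcomp Require Import all_classical all_reals all_analysis.
From mathcomp Require Import zify ring lra.
Set Implicit Arguments.
Unset Strict Implicit.
Unset Printing Implicit Defensive.
Import Order.TTheory GRing.Theory Num.Theory.
Import numFieldNormedType.Exports.
Local Open Scope classical_set_scope.
Local Open Scope ring_scope.

Section combinatorics.
Local Open Scope nat_scope.

(** * Cycle factorisations *)

(** This counts the insertion vectors. No entry exceeds the sum [r], so the bound [m] on the entries
    can be lowered to [r], where the number of weak compositions is known. The case [N = 0] is
    separate because the predecessor may be truncated there. *)
Lemma card_bounded_ord_partitions N m r : r <= m ->
  #|[set v : N.-tuple 'I_m.+1 | \sum_(i <- v) i == r]%SET| = 'C((N + r).-1, r).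
Proof.
move=> rm.
have le_rm : r.+1 <= m.+1 by [].
have -> : [set v : N.-tuple 'I_m.+1 | \sum_(i <- v) i == r]%SET =
    [set map_tuple (widen_ord le_rm) v | v : N.-tuple 'I_r.+1
       in [set v : N.-tuple 'I_r.+1 | \sum_(i <- v) i == r]%SET]%SET.
  apply/setP => v; rewrite inE; apply/idP/imsetP => [|[u]]; last first.
    by rewrite inE => + ->; rewrite big_map.
  move=> /eqP vr.
  have le_r i : i \in tval v -> i < r.+1.
    by move=> iv; rewrite ltnS -vr (big_rem i iv) /= leq_addr.
  have vE : map (fun i : 'I_m.+1 => widen_ord le_rm (inord i)) v = v.
    rewrite -[RHS]map_id; apply/eq_in_map => i iv; apply: val_inj => /=.
    by rewrite inordK // le_r.
  exists (map_tuple (fun i : 'I_m.+1 => inord i) v); last first.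
    by apply: val_inj => /=; rewrite -map_comp vE.
  rewrite inE big_map -[X in _ == X]vr -[X in _ == \sum_(i <- X) _]vE big_map.
  exact/eqP.
rewrite card_imset; last first.
  move=> u v /(congr1 val) /= /inj_map uv; apply/val_inj/uv => i j.
  by move=> /(congr1 val) /= ij; apply: val_inj.
case: N => [|N]; last first.
  rewrite addSn /= card_ord_partitions; have := bin_sub (leq_addl N r).
  by rewrite addnK.
case: r {rm le_rm} => [|r].
  rewrite bin0; apply: (@fintype.eq_card1 _ [tuple]) => v.
  by rewrite !inE (tuple0 v) big_nil; exact/esym/eqP.
rewrite add0n bin_small //; apply: fintype.eq_card0 => v.
by rewrite !inE (tuple0 v) big_nil.
Qed.

(** * Two-line arrays up to stable sorting *)

Definition le_top := fun p q : nat * nat => p.1 <= q.1.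

Lemma le_top_total : total le_top.
Proof. by move=> p q; exact: leq_total. Qed.

Lemma le_top_trans : transitive le_top.
Proof. by move=> p q r; exact: leq_trans. Qed.

(** Stable sorting keeps every fiber, and a sorted array is determined by its fibers; equality of
    multiset permutations can thus be tested one top letter at a time. *)
Definition fiber (a : nat) (C : seq (nat * nat)) := [seq p <- C | p.1 == a].

Lemma fiber_cat a C D : fiber a (C ++ D) = fiber a C ++ fiber a D.
Proof. exact: filter_cat. Qed.

Lemma fiber_sort a C : fiber a (sort le_top C) = fiber a C.
Proof.
rewrite /fiber (filter_sort le_top_total le_top_trans).
apply: sorted_sort; first exact: le_top_trans.
rewrite (@sorted_pairwise _ _ le_top_trans); apply/(pairwiseP (0, 0)) => i j.
move=> iC jC _.
have := mem_nth (0, 0) iC; have := mem_nth (0, 0) jC.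
by rewrite !mem_filter /le_top => /andP[/eqP-> _] /andP[/eqP-> _].
Qed.

Lemma eq_fiber_sorted C D : sorted le_top C -> sorted le_top D ->
  (forall a, fiber a C = fiber a D) -> C = D.
Proof.
elim: C D => [|p C IH] [|q D] //=.
- by move=> _ _ /(_ q.1); rewrite /fiber /= eqxx.
- by move=> _ _ /(_ p.1); rewrite /fiber /= eqxx.
rewrite !(path_sortedE le_top_trans) => /andP[/allP pC sC] /andP[/allP qD sD] CD.
have le_pq p' q' C' D' : {in D', forall r, le_top q' r} ->
    fiber p'.1 (p' :: C') = fiber p'.1 (q' :: D') -> q'.1 <= p'.1.
  move=> q'D' E.
  have : p' \in fiber p'.1 (p' :: C') by rewrite mem_filter eqxx mem_head.
  rewrite E.
  by rewrite mem_filter inE => /andP[_ /orP[/eqP-> //|/q'D']].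
have pq : p.1 = q.1.
  apply/eqP; rewrite eqn_leq (le_pq q p D C pC (esym (CD q.1))).
  exact: (le_pq p q C D qD (CD p.1)).
have := CD p.1; rewrite /fiber /= eqxx -pq eqxx => -[pqE _].
congr (_ :: _) => //; apply: IH => // a; have := CD a.
by rewrite /fiber /= -pqE; case: ifP => // _ [].
Qed.

Lemma eq_fiber_sort C D : (forall a, fiber a C = fiber a D) ->
  sort le_top C = sort le_top D.
Proof.
move=> CD; apply: eq_fiber_sorted => [||a]; last by rewrite !fiber_sort.
- exact/sort_sorted/le_top_total.
- exact/sort_sorted/le_top_total.
Qed.

Definition balanced (C : seq (nat * nat)) := perm_eq (unzip1 C) (unzip2 C).

Lemma balanced_cat C D : balanced C -> balanced D -> balanced (C ++ D).
Proof. by rewrite /balanced /unzip1 /unzip2 !map_cat; exact: perm_cat. Qed.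

Lemma two_line_of_columns C : balanced C ->
  two_line (of_columns C) = sort le_top C.
Proof.
move=> bC; rewrite /two_line /of_columns -/le_top.
have -> : sort leq (unzip2 (sort le_top C)) = unzip1 (sort le_top C).
  apply: (sorted_eq leq_trans anti_leq).
  - exact/sort_sorted/leq_total.
  - by rewrite sorted_map; exact/sort_sorted/le_top_total.
  - rewrite perm_sort perm_sym (perm_trans (y := unzip1 C)) //.
      by apply: perm_map; rewrite perm_sort.
    rewrite (perm_trans bC) //.
    by apply: perm_map; rewrite perm_sym perm_sort.
exact: zip_unzip.
Qed.

(** Sorting each factor beforehand changes no fiber of the juxtaposition, so one final sort
    suffices. Iterated, this turns a whole product of cycles into a single sort. *)
Lemma intercalation_of_columns C D : balanced C -> balanced D ->
  intercalation (of_columns C) (of_columns D) = of_columns (C ++ D).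
Proof.
move=> bC bD; rewrite /intercalation !two_line_of_columns // /of_columns -/le_top.
by congr unzip2; apply: eq_fiber_sort => a; rewrite !fiber_cat !fiber_sort.
Qed.

Definition cycle_columns (c : seq nat) := zip c (rot 1 c).

Lemma balanced_cycle_columns c : balanced (cycle_columns c).
Proof.
by rewrite /balanced unzip1_zip ?unzip2_zip ?size_rot // perm_sym perm_rot.
Qed.

Definition columns (f : seq (seq nat)) := flatten (map cycle_columns f).

Lemma balanced_columns f : balanced (columns f).
Proof.
elim: f => //= c f IH; apply: balanced_cat => //; exact: balanced_cycle_columns.
Qed.

Lemma intercalation_cycles f :
  foldr intercalation [::] (map cycle_perm f) = of_columns (columns f).
Proof.
elim: f => //= c f ->.
apply: intercalation_of_columns; first exact: balanced_cycle_columns.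
exact: balanced_columns.
Qed.

Lemma perm_of_columns f : perm_eq (of_columns (columns f)) (flatten f).
Proof.
apply: (@perm_trans _ (unzip2 (columns f))).
  by apply: perm_map; rewrite perm_sort.
rewrite perm_sym; apply: perm_trans (balanced_columns f); rewrite perm_sym.
elim: f => //= c f IH; rewrite /unzip1 map_cat -/(unzip1 _).
by rewrite unzip1_zip ?size_rot // perm_cat2l.
Qed.

(** * Uniqueness of the cycle factorisation *)

Lemma normal_cycleP c : reflect
  (exists s y, c = rcons s y /\ all (fun z => y < z) s) (normal_cycle c).
Proof.
apply: (iffP idP) => [|[s [y [-> sy]]]].
  case: c => [//|x s'] h; exists (belast x s'), (last x s').
  by rewrite -lastI.
by case: s sy => [|x s] //= sy; rewrite last_rcons belast_rcons.
Qed.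

(* Consecutive letters of a :: l; after rotating a cycle so that its smallest
   letter comes first, its columns are read along such a walk. *)
Fixpoint walk (a : nat) (l : seq nat) : seq (nat * nat) :=
  if l is b :: l' then (a, b) :: walk b l' else [::].

Lemma walk_zip x s y : walk x (rcons s y) = zip (x :: s) (rcons s y).
Proof. by elim: s x => [|z s IH] x //=; rewrite IH. Qed.

(** The two arrays differ only in the place of the column with top letter [y], last in one and first
    in the other. As [y] is smaller than the rest of the cycle, that column is alone in its fiber
    and its place is invisible. *)
Lemma fiber_cycle_columns s y a : all (fun z => y < z) s ->
  fiber a (cycle_columns (rcons s y)) = fiber a (walk y (rcons s y)).
Proof.
rewrite /cycle_columns; case: s => [//|x s] /=.
rewrite rot1_cons /= => /andP[yx ys]; rewrite -rcons_cons -[rcons (x :: s) y]cats1.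
rewrite -[rcons (rcons s y) x]cats1 zip_cat ?size_rcons // walk_zip.
rewrite fiber_cat [X in _ ++ X]/fiber /=.
have [->|ay] := eqVneq a y; last by rewrite cats0.
suff -> : fiber y (zip (x :: s) (rcons s y)) = [::] by [].
apply/eqP; rewrite -size_eq0 size_filter -[_ == 0]negbK -lt0n -has_count.
apply/hasPn => p pin; have : p.1 \in unzip1 (zip (x :: s) (rcons s y)).
  exact: map_f.
rewrite unzip1_zip ?size_rcons // => /= pxs; apply/eqP => py.
by move: pxs; rewrite py inE (ltn_eqF yx) /= => /(allP ys); rewrite ltnn.
Qed.

(** The first column in the fiber of the current letter [b] dictates the next letter, so both walks
    make the same moves and stop together at [y]. Removing the columns used leaves equal fibers. *)
Lemma walk_inj s s' b y C C' : y \notin s -> y \notin s' ->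
  (forall a, fiber a (walk b (rcons s y) ++ C) =
             fiber a (walk b (rcons s' y) ++ C')) ->
  s = s' /\ forall a, fiber a C = fiber a C'.
Proof.
have strip p D D' : (forall a, fiber a (p :: D) = fiber a (p :: D')) ->
    forall a, fiber a D = fiber a D'.
  move=> DD' a; have := DD' a; rewrite /fiber /=; case: ifP => // _ [//].
elim: s s' b => [|x s IH] [|x' s'] b /= ys ys' E.
- by split => //; exact: strip E.
- have := E b; rewrite /fiber /= eqxx => -[yx'].
  by rewrite yx' mem_head in ys'.
- have := E b; rewrite /fiber /= eqxx => -[xy].
  by rewrite xy mem_head in ys.
- have := E b; rewrite /fiber /= eqxx => -[xx' _]; subst x'.
  move: ys ys'; rewrite !inE !negb_or => /andP[_ ys] /andP[_ ys'].
  by have [->] := IH _ _ ys ys' (strip _ _ _ E).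
Qed.

(** The last letter of a normal cycle is its least, and the last letters increase weakly along the
    list. The minimum of the first cycle is thus the least top letter, which the fibers
    determine. *)
Lemma last_le_top c f p : all normal_cycle (c :: f) ->
  sorted leq (map (last 0) (c :: f)) -> p \in columns (c :: f) ->
  last 0 c <= p.1.
Proof.
move=> nf; rewrite /= (path_sortedE leq_trans) => /andP[/allP le_c _].
rewrite /columns => /flattenP[D /mapP[c' c'f ->]] pc'.
have : p.1 \in unzip1 (cycle_columns c') by exact: map_f.
rewrite unzip1_zip ?size_rot // => pin.
apply: (@leq_trans (last 0 c')).
  move: c'f; rewrite inE => /orP[/eqP-> //|c'f].
  by apply: le_c; exact: map_f.
have /normal_cycleP[s [y [E ys]]] := allP nf _ c'f.
move: pin; rewrite E last_rcons mem_rcons inE => /orP[/eqP-> //|].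
by move=> /(allP ys)/ltnW.
Qed.

(** Induction on the first cycle: its last letter is the least top letter, hence common to both
    sides; the walk from that letter recovers the cycle and leaves equal fibers for the remaining
    ones. *)
Lemma columns_inj f f' : all normal_cycle f -> all normal_cycle f' ->
  sorted leq (map (last 0) f) -> sorted leq (map (last 0) f') ->
  (forall a, fiber a (columns f) = fiber a (columns f')) -> f = f'.
Proof.
have nil0 c f0 : normal_cycle c ->
    ~ (forall a, fiber a [::] = fiber a (columns (c :: f0))).
  case: c => [//|x c] _ /(_ x); rewrite /columns /cycle_columns /= rot1_cons.
  by case: c => [|z c]; rewrite /fiber /= eqxx.
(* The minimum of [c'] is a top letter on the right, hence by equality of fibers also on the left,
   where no top letter is below [last 0 c]. *)
have first_le c f1 c' f2 : all normal_cycle (c :: f1) ->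
    all normal_cycle (c' :: f2) -> sorted leq (map (last 0) (c :: f1)) ->
    (forall a, fiber a (columns (c :: f1)) = fiber a (columns (c' :: f2))) ->
    last 0 c <= last 0 c'.
  move=> nf nf' sf E.
  have /normal_cycleP[s [y [c'E ys]]] := allP nf' _ (mem_head _ _).
  have yin : (y, head y s) \in columns (c' :: f2).
    rewrite mem_cat; apply/orP; left.
    have : (y, head y s) \in fiber y (cycle_columns c').
      by rewrite c'E fiber_cycle_columns //; case: s {c'E ys} => [|x s];
         rewrite /fiber /= eqxx mem_head.
    by rewrite mem_filter => /andP[].
  rewrite c'E last_rcons; apply: (last_le_top (p := (y, head y s)) nf sf).
  have : (y, head y s) \in fiber y (columns (c :: f1)).
    by rewrite E mem_filter /= eqxx.
  by rewrite mem_filter => /andP[].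
elim: f f' => [|c f IH] [|c' f'] //.
- by move=> _ /= /andP[nc' _] _ _ /(nil0 _ _ nc').
- by move=> /= /andP[nc _] _ _ _ E; case: (nil0 _ f nc) => a; rewrite E.
move=> nf nf' sf sf' E.
have cc' : last 0 c = last 0 c'.
  by apply/eqP; rewrite eqn_leq (first_le _ f _ f') //= (first_le _ f' _ f).
have /normal_cycleP[s [y [cE ys]]] := allP nf _ (mem_head _ _).
have /normal_cycleP[s' [y' [cE' ys']]] := allP nf' _ (mem_head _ _).
have yy' : y' = y by move: cc'; rewrite cE cE' !last_rcons.
subst y' c c'.
have notin s0 : all (fun z => y < z) s0 -> y \notin s0.
  by move=> ys0; apply/negP => /(allP ys0); rewrite ltnn.
have [|-> E'] := walk_inj (b := y) (C := columns f) (C' := columns f')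
  (notin _ ys) (notin _ ys').
  move=> a; have := E a; rewrite /columns /= !fiber_cat.
  by rewrite !fiber_cycle_columns.
congr (_ :: _); move: nf nf' sf sf' => /= /andP[_ nf] /andP[_ nf'].
by move=> /path_sorted sf /path_sorted sf'; exact: IH.
Qed.

Lemma cycle_factorisation_uniq w f f' : is_cycle_factorisation w f ->
  is_cycle_factorisation w f' -> f = f'.
Proof.
move=> /and3P[nf sf /eqP wf] /and3P[nf' sf' /eqP wf'].
apply: columns_inj => // a.
move: wf wf'; rewrite !intercalation_cycles => -> /(congr1 two_line).
rewrite !two_line_of_columns; try exact: balanced_columns.
by move=> /(congr1 (fiber a)); rewrite !fiber_sort.
Qed.

Lemma cycle_factorisationE w f : is_cycle_factorisation w f ->
  cycle_factorisation w = f.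
Proof.
move=> wf; apply: xget_unique => // f' wf'; exact: cycle_factorisation_uniq wf' wf.
Qed.

(** * Effect of an insertion step *)

Lemma insert_copies_rcons t v m c y : size v = size c ->
  insert_copies t (rcons v m) (rcons c y) =
  rcons (insert_copies t v c ++ nseq m t) y.
Proof.
move=> vc; rewrite /insert_copies zip_rcons // map_rcons flatten_rcons /=.
by rewrite -rcons_cat.
Qed.

Lemma perm_insert_copies t v c : size v = size c ->
  perm_eq (insert_copies t v c) (nseq (sumn v) t ++ c).
Proof.
elim: v c => [|m v IH] [|y c] //= [vc].
rewrite /insert_copies /= nseqD cat_rcons -catA perm_cat2l.
by rewrite perm_sym perm_catC /= perm_cons perm_catC perm_sym IH.
Qed.

(** Copies go only to the left of existing letters, so the last letter stays last; as [t] exceeds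
    every letter of [c], that letter also stays strictly smaller than the others. *)
Lemma normal_insert_copies t v c : size v = size c -> normal_cycle c ->
  all (fun z => z < t) c ->
  normal_cycle (insert_copies t v c) /\ last 0 (insert_copies t v c) = last 0 c.
Proof.
move=> vc /normal_cycleP[s [y [E ys]]]; subst c.
move: vc; case/lastP: v => [|v m]; first by rewrite size_rcons.
rewrite !size_rcons => -[vs]; rewrite all_rcons => /andP[yt st].
rewrite insert_copies_rcons // !last_rcons; split=> //.
apply/normal_cycleP; do 2 eexists; split; first by [].
rewrite all_cat all_nseq yt orbT andbT.
by rewrite (perm_all _ (perm_insert_copies t vs)) all_cat all_nseq yt orbT.
Qed.

Lemma size_insert_parts (v : seq nat) (f : seq (seq nat)) : size v = size (flatten f) ->
  size (zip (reshape (shape f) v) f) = size f.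
Proof. by move=> vf; rewrite size2_zip // size_reshape size_map. Qed.

Lemma perm_crp_insert t k v f : size v = size (flatten f) ->
  perm_eq (flatten (crp_insert t k v f)) (nseq (sumn v + k) t ++ flatten f).
Proof.
rewrite /crp_insert flatten_cat nseqD -catA => vf.
have -> : flatten (nseq k [:: t]) = nseq k t by elim: k => //= k ->.
rewrite perm_sym perm_catCA perm_sym perm_catC perm_cat2l.
elim: f v vf => [|c f IH] v /= vf; first by case: v vf.
have vc : size (take (size c) v) = size c.
  by apply: size_takel; rewrite vf size_cat leq_addr.
have vf' : size (drop (size c) v) = size (flatten f).
  by rewrite size_drop vf size_cat addKn.
rewrite -[in sumn v](cat_take_drop (size c) v) sumn_cat nseqD.
have := perm_cat (perm_insert_copies t vc) (IH _ vf').
move=> /perm_trans; apply; rewrite -!catA perm_cat2l.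
by rewrite perm_catCA.
Qed.

(** Insertion preserves the last letters of the old cycles, and the appended cycles end in [t],
    which is larger. *)
Lemma crp_insert_normal t k v f : size v = size (flatten f) ->
  all normal_cycle f -> sorted leq (map (last 0) f) ->
  all (fun z => z < t) (flatten f) ->
  all normal_cycle (crp_insert t k v f) /\
  sorted leq (map (last 0) (crp_insert t k v f)).
Proof.
move=> vf nf sf ft.
have [] : all normal_cycle [seq insert_copies t p.1 p.2
              | p <- zip (reshape (shape f) v) f] /\
    map (last 0) [seq insert_copies t p.1 p.2
              | p <- zip (reshape (shape f) v) f] = map (last 0) f.
  elim: f v vf nf ft {sf} => [|c f IH] v //= vf /andP[nc nf].
  rewrite all_cat => /andP[ct ft].
  have vc : size (take (size c) v) = size c.
    by apply: size_takel; rewrite vf size_cat leq_addr.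
  have vf' : size (drop (size c) v) = size (flatten f).
    by rewrite size_drop vf size_cat addKn.
  by have [-> ->] := normal_insert_copies vc nc ct; have [-> ->] := IH _ vf' nf ft.
rewrite /crp_insert all_cat map_cat => -> ->; split.
  by rewrite all_nseq orbT.
have -> : map (last 0) (nseq k [:: t]) = nseq k t by elim: (k) => //= ? ->.
rewrite (sorted_pairwise leq_trans) pairwise_cat -(sorted_pairwise leq_trans) sf /=.
rewrite -(sorted_pairwise leq_trans); apply/andP; split.
  apply/allrelP => y z /mapP[c cf ->] /nseqP[-> _].
  have /normal_cycleP[s [y' [cE _]]] := allP nf _ cf.
  apply/ltnW/(allP ft)/flattenP; exists c => //.
  by rewrite cE last_rcons mem_rcons mem_head.
by case: k => //= k; elim: k => //= k ->; rewrite leqnn.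
Qed.

Lemma mset_recr n t : Defs.mset n t.+1 = Defs.mset n t ++ nseq (n t.+1) t.+1.
Proof.
have E := iotaD 1 t 1; rewrite addn1 add1n in E.
by rewrite /Defs.mset E map_cat flatten_cat /= cats0.
Qed.

Lemma size_mset n t : size (Defs.mset n t) = msize n t.
Proof.
elim: t => [|t IH]; first by rewrite /msize big_geq.
by rewrite mset_recr size_cat IH size_nseq /msize [RHS]big_nat_recr.
Qed.

Lemma mset_le n t : all (fun z => z <= t) (Defs.mset n t).
Proof.
elim: t => // t IH; rewrite mset_recr all_cat all_nseq leqnn orbT andbT.
by apply: sub_all IH => z /leqW.
Qed.

Lemma factorisation_perm w f : is_cycle_factorisation w f -> perm_eq w (flatten f).
Proof.
by move=> /and3P[_ _ /eqP->]; rewrite intercalation_cycles perm_of_columns.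
Qed.

(** By uniqueness, the list of cycles built by the step is the factorisation of the new permutation,
    so its length is the new number of cycles. *)
Lemma crp_step_factorisation n t k v w f : is_mperm n t w ->
  is_cycle_factorisation w f -> size v = msize n t -> sumn v + k = n t.+1 ->
  [/\ is_mperm n t.+1 (crp_step t.+1 k v w),
      is_cycle_factorisation (crp_step t.+1 k v w) (crp_insert t.+1 k v f)
    & num_cycles (crp_step t.+1 k v w) = num_cycles w + k].
Proof.
move=> wn wf vn vk; have pwf := factorisation_perm wf.
have vf : size v = size (flatten f).
  by rewrite vn -size_mset -(perm_size wn) (perm_size pwf).
have ft : all (fun z => z < t.+1) (flatten f).
  by rewrite -(perm_all _ pwf) (perm_all _ wn) mset_le.
have /and3P[nf sf _] := wf.
have step : crp_step t.+1 k v w = of_columns (columns (crp_insert t.+1 k v f)).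
  by rewrite /crp_step (cycle_factorisationE wf) intercalation_cycles.
have wf' : is_cycle_factorisation (crp_step t.+1 k v w) (crp_insert t.+1 k v f).
  have [nf' sf'] := crp_insert_normal k vf nf sf ft.
  by rewrite /is_cycle_factorisation nf' sf' step intercalation_cycles eqxx.
split => //.
  rewrite /is_mperm mset_recr; apply: perm_trans (factorisation_perm wf') _.
  apply: perm_trans (perm_crp_insert _ _ vf) _.
  by rewrite perm_catC vk perm_cat2r -(permPl pwf).
rewrite /num_cycles (cycle_factorisationE wf') (cycle_factorisationE wf).
by rewrite /crp_insert size_cat size_map size_insert_parts // size_nseq.
Qed.

Lemma cycle_factorisation_nil : is_cycle_factorisation [::] [::].
Proof. by []. Qed.

Lemma num_cycles_nil : num_cycles [::] = 0.
Proof. by rewrite /num_cycles (cycle_factorisationE cycle_factorisation_nil). Qed.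

End combinatorics.

(** * The law of the number of cycles *)
Section discrete.
Context (R : realType) (d : measure_display) (T : measurableType d).
Context (P : probability T R) (S : choiceType) (X : T -> S) (r : seq S).
Hypothesis mX : forall s, measurable (X @^-1` [set s]).
Hypothesis Xr : forall x, X x \in r.
Hypothesis ur : uniq r.

Definition pmass (s : S) : R := fine (P (X @^-1` [set s])).

Lemma pmassE s : P (X @^-1` [set s]) = (pmass s)%:E.
Proof. by rewrite /pmass fineK// fin_num_measure. Qed.

Lemma pmass_ge0 s : 0 <= pmass s.
Proof. by rewrite fine_ge0. Qed.

Lemma measure_partition A : measurable A ->
  P A = (\sum_(s <- r) P (A `&` X @^-1` [set s]))%E.
Proof.
move=> mA; rewrite fsbig_seq// -measure_fin_bigcup//.
- congr (P _); apply/seteqP; split => [x Ax|x [s _ []]//].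
  by exists (X x) => //; exact: Xr.
- by apply/trivIsetP => s u _ _ su; apply/seteqP; split => // x [[_ /= Es] [_ /= Eu]];
    rewrite -Es -Eu eqxx in su.
- by move=> s _; exact: measurableI.
Qed.

Lemma measurable_discrete (Q : pred S) : measurable [set x | Q (X x)].
Proof.
rewrite (_ : mkset _ = \bigcup_(s in [set` [seq s <- r | Q s]]) (X @^-1` [set s])).
  by apply: fin_bigcup_measurable => // s _; exact: mX.
apply/seteqP; split => [x /= Qx|x [s]].
  by exists (X x) => //=; rewrite mem_filter Qx Xr.
by rewrite /= mem_filter => /andP[Qs _] ->.
Qed.

Lemma discrete_expectation (h : S -> R) :
  'E_P[fun x => h (X x)]%E = (\sum_(s <- r) pmass s * h s)%:E.
Proof.
rewrite unlock -sumEFin.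
transitivity (\int[P]_x \sum_(s <- r) ((h s)%:E * (\1_(X @^-1` [set s]) x)%:E))%E.
  apply: eq_integral => x _.
  rewrite (bigD1_seq (X x))//= indicE mem_set//= mule1 big1 ?adde0// => s sx.
  by rewrite indicE memNset ?mule0// => /= Xs; rewrite Xs eqxx in sx.
have int1 s : P.-integrable setT (fun x => (\1_(X @^-1` [set s]) x)%:E).
  exact/integrable_indic/mX.
rewrite integral_sum//; last by move=> s; exact: integrableZl.
apply: eq_bigr => s _; rewrite (integralZl _ (int1 s))// integral_indic//.
by rewrite setIT EFinM muleC; congr (_ * _)%E; exact: pmassE.
Qed.

Lemma discrete_probability (Q : pred S) :
  P [set x | Q (X x)] = (\sum_(s <- r) pmass s * (Q s)%:R)%:E.
Proof.
rewrite -discrete_expectation unlock.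
rewrite -[LHS](_ : \int[P]_x (\1_[set x | Q (X x)] x)%:E = _)%E.
  apply: eq_integral => x _; rewrite indicE; congr (_%:R%:E).
  by case: (boolP (Q (X x))) => Qx; [rewrite mem_set|rewrite memNset//=; exact/negP].
by rewrite integral_indic ?setIT//; exact: measurable_discrete.
Qed.

End discrete.

(** * The Markov chain and the recursion for the law of its number of cycles *)

Section law.
Context (R : realType) (d : measure_display) (T : measurableType d).
Context (P : probability T R) (n : nat -> nat) (theta : R).
Context (Pi : nat -> T -> seq nat).
Hypothesis crpPi : is_multiset_crp P n theta Pi.

Definition states t := permutations (Defs.mset n t).

Let mPi t w : measurable (Pi t @^-1` [set w]).
Proof. exact: (crp_measurable crpPi). Qed.

Lemma crp_states t x : Pi t x \in states t.
Proof. by rewrite mem_permutations; exact: (crp_mperm crpPi). Qed.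

Let uniq_states t : uniq (states t).
Proof. exact: permutations_uniq. Qed.

Local Notation trans := (crp_transition n theta).

Definition tail_event (w : nat -> seq nat) s t : set T :=
  [set x | forall r, (s <= r <= t)%N -> Pi r x = w r].

Lemma measurable_tail_event w s t : measurable (tail_event w s t).
Proof.
rewrite (_ : tail_event w s t = \bigcap_r
    (if (s <= r <= t)%N then Pi r @^-1` [set w r] else setT)).
  by apply: bigcapT_measurable => r; case: ifP.
apply/seteqP; split => x /= h r.
  by move=> _; case: ifPn => // /h.
by move=> srt; have := h r I; rewrite srt.
Qed.

(** The Markov property is given for complete pasts. Induction on [s] forgets one more state: the
    event is split by the value of [Pi s], and the transition factor, which involves only times [t]
    and [t.+1], leaves the sum. *)
Lemma tail_markov w s t : (s <= t)%N ->
  P (tail_event w s t.+1) =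
  (P (tail_event w s t) * (trans t.+1 (w t) (w t.+1))%:E)%E.
Proof.
elim: s w => [|s IH] w st.
  have E r : tail_event w 0 r = path_event Pi w r by [].
  by rewrite !E (crp_markov crpPi).
pose upd u := fun r => if r == s then u else w r : seq nat.
have updE r u : (s <= r)%N ->
    tail_event w s.+1 r `&` Pi s @^-1` [set u] = tail_event (upd u) s r.
  move=> sr; apply/seteqP; split => x /=.
    move=> [h E] q /andP[sq qr]; rewrite /upd; case: eqVneq => [-> //|qs].
    by apply: h; rewrite qr andbT ltn_neqAle eq_sym qs.
  move=> h; split; last by rewrite h ?leqnn ?sr// /upd eqxx.
  move=> q /andP[sq qr]; rewrite h ?qr ?(ltnW sq)//.
  by rewrite /upd gtn_eqF.
rewrite !(measure_partition P (mPi s) (@crp_states s) (uniq_states s)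
  (measurable_tail_event _ _ _)).
rewrite ge0_sume_distrl//; apply: eq_bigr => u _.
rewrite !updE ?(ltnW st)// ?leqW ?(ltnW st)// IH ?(ltnW st)//.
by rewrite /upd !gtn_eqF// ltnS ltnW.
Qed.

Local Notation q t := (pmass P (Pi t)).

Lemma joint_two t a b :
  P (Pi t @^-1` [set a] `&` Pi t.+1 @^-1` [set b]) =
  (q t a * trans t.+1 a b)%:E.
Proof.
pose w r := if r == t then a else b.
have wt : w t = a by rewrite /w eqxx.
have wt1 : w t.+1 = b by rewrite /w gtn_eqF.
have E0 : Pi t @^-1` [set a] = tail_event w t t.
  apply/seteqP; split => x /=; last by move=> h; rewrite h ?leqnn.
  move=> h r /andP[tr rt]; rewrite (_ : r = t) ?wt//.
  by apply/eqP; rewrite eqn_leq tr rt.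
have E1 : Pi t @^-1` [set a] `&` Pi t.+1 @^-1` [set b] = tail_event w t t.+1.
  apply/seteqP; split => x /=.
    move=> [ha hb] r /andP[tr]; rewrite leq_eqVlt => /orP[/eqP->|rt].
      by rewrite wt1.
    rewrite (_ : r = t) ?wt//.
    by apply/eqP; rewrite eqn_leq -ltnS rt tr.
  by move=> h; split; rewrite h ?wt ?wt1// leqnn leqnSn.
by rewrite E1 tail_markov// -E0 wt wt1 EFinM; congr (_ * _)%E; exact: pmassE.
Qed.

Lemma pmass_recr t b :
  q t.+1 b = \sum_(a <- states t) q t a * trans t.+1 a b.
Proof.
apply: EFin_inj; rewrite -pmassE// -sumEFin.
rewrite (measure_partition P (mPi t) (@crp_states t) (uniq_states t))//.
by apply: eq_bigr => a _; rewrite setIC joint_two.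
Qed.

Definition step_mass t k : R :=
  'C((msize n t.-1 + (n t - k)).-1, n t - k)%:R * theta ^+ k / crp_F n theta t.

(** Each choice of [k] and of an insertion vector leads to exactly one state, with
    [num_cycles a + k] cycles. For a given [k] all vectors contribute equally and only have to be
    counted. *)
Lemma crp_transition_sum t a (h : nat -> R) : is_mperm n t a ->
  (exists f, is_cycle_factorisation a f) ->
  \sum_(b <- states t.+1) trans t.+1 a b * h (num_cycles b) =
  \sum_(k < (n t.+1).+1) step_mass t.+1 k * h (num_cycles a + k)%N.
Proof.
move=> an [f af].
under eq_bigr do rewrite /crp_transition mulr_suml.
rewrite exchange_big/=; apply: eq_bigr => k _.
under eq_bigr do rewrite mulr_suml.
pose r := (n t.+1 - k)%N.
transitivity (\sum_(v : (msize n t).-tuple 'I_(n t.+1).+1 | (\sum_(i <- v) i == r)%N)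
    theta ^+ k / crp_F n theta t.+1 * h (num_cycles a + k)%N).
  under eq_bigr do rewrite big_mkcondr.
  rewrite exchange_big/=; apply: eq_bigr => v /eqP vr.
  have kn : (k <= n t.+1)%N by rewrite -ltnS.
  have vn : size [seq val i | i <- v] = msize n t by rewrite size_map size_tuple.
  have vk : (sumn [seq val i | i <- v] + k = n t.+1)%N.
    by rewrite sumnE big_map vr subnK.
  have [cn _ ck] := crp_step_factorisation an af vn vk.
  rewrite (bigD1_seq (crp_step t.+1 k [seq val i | i <- v] a))//=; last first.
    by rewrite mem_permutations.
  by rewrite eqxx ck big1 ?addr0// => b; rewrite eq_sym => /negbTE->.
rewrite sumr_const -[X in _ *+ X]cardsE card_bounded_ord_partitions ?leq_subr//.
rewrite -[LHS]mulr_natl /step_mass /= -/r; ring.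
Qed.

Lemma crp_transition_neq0 t a b : is_mperm n t a ->
  (exists f, is_cycle_factorisation a f) -> trans t.+1 a b != 0 ->
  (exists f, is_cycle_factorisation b f) /\ (num_cycles a <= num_cycles b)%N.
Proof.
move=> an [f af] /eqP tr; apply: contrapT => nb; apply: tr.
rewrite /crp_transition big1// => k _; rewrite big1// => v /andP[/eqP vr /eqP vb].
case: nb.
have kn : (k <= n t.+1)%N by rewrite -ltnS.
have vn : size [seq val i | i <- v] = msize n t by rewrite size_map size_tuple.
have vk : (sumn [seq val i | i <- v] + k = n t.+1)%N.
  by rewrite sumnE big_map vr subnK.
have [_ cf ck] := crp_step_factorisation an af vn vk.
by rewrite -vb; split; [eexists; exact: cf|rewrite ck leq_addr].
Qed.

(** Existence propagates along the chain: a state of positive mass is reached with nonzero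
    probability from one of positive mass, and a step turns a factorisation into a factorisation. *)
Lemma crp_reachable t w : 0 < q t w -> exists f, is_cycle_factorisation w f.
Proof.
elim: t w => [|t IH] w.
  move=> qw; exists [::]; suff -> : w = [::] by [].
  apply/eqP/negPn/negP => w0; move: qw; rewrite /pmass (_ : _ @^-1` _ = set0).
    by rewrite measure0 ltxx.
  apply/seteqP; split => // x /=; rewrite (crp_init crpPi) => /esym.
  exact/eqP.
rewrite pmass_recr => qw.
have [a ain qa] : exists2 a, a \in states t & 0 < q t a * trans t.+1 a w.
  apply: contrapT => h; move: qw; rewrite ltNge => /negP; apply.
  rewrite big_seq; apply: sumr_le0 => a ain; rewrite leNgt; apply/negP => qa.
  by apply: h; exists a.
have {}qa0 : 0 < q t a.
  by rewrite lt_neqAle pmass_ge0 andbT eq_sym; apply: contraTneq qa => ->;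
     rewrite mul0r ltxx.
have an : is_mperm n t a by rewrite mem_permutations in ain.
have tr : trans t.+1 a w != 0 by apply: contraTneq qa => ->; rewrite mulr0 ltxx.
by have [] := crp_transition_neq0 an (IH _ qa0) tr.
Qed.

Definition cycle_law t (h : nat -> R) : R :=
  \sum_(w <- states t) q t w * h (num_cycles w).

Lemma cycle_law0 h : cycle_law 0 h = h 0%N.
Proof.
rewrite /cycle_law /states /Defs.mset /= big_seq1 num_cycles_nil.
rewrite /pmass (_ : _ @^-1` _ = setT) ?probability_setT ?mul1r//.
by apply/seteqP; split => // x _ /=; rewrite (crp_init crpPi).
Qed.

(** After conditioning on the state at time [t], the transition sum depends on that state only
    through its number of cycles. States of mass zero are put aside, since the factorisation is
    provided for states of positive mass. *)
Lemma cycle_law_recr t h : cycle_law t.+1 h =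
  \sum_(k < (n t.+1).+1) step_mass t.+1 k * cycle_law t (fun j => h (j + k)%N).
Proof.
rewrite /cycle_law; under eq_bigr do rewrite pmass_recr mulr_suml.
rewrite exchange_big/=; under [RHS]eq_bigr do rewrite mulr_sumr.
rewrite [RHS]exchange_big/= big_seq [RHS]big_seq; apply: eq_bigr => a ain.
under eq_bigr do rewrite -mulrA; rewrite -mulr_sumr.
under [RHS]eq_bigr do rewrite mulrCA.
rewrite -mulr_sumr; have [->|qa] := eqVneq (q t a) 0; first by rewrite !mul0r.
congr (_ * _); apply: crp_transition_sum; first by rewrite mem_permutations in ain.
by apply: (@crp_reachable t); rewrite lt_neqAle eq_sym qa pmass_ge0.
Qed.

Lemma cycle_expectation t (h : nat -> R) :
  'E_P[fun x => h (num_cycles (Pi t x))]%E = (cycle_law t h)%:E.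
Proof.
exact: (discrete_expectation P (mPi t) (@crp_states t) (uniq_states t)
  (fun w => h (num_cycles w))).
Qed.

Lemma measurable_cycle t (Q : pred nat) : measurable [set x | Q (num_cycles (Pi t x))].
Proof.
exact: (measurable_discrete (mPi t) (@crp_states t) (fun w => Q (num_cycles w))).
Qed.

Lemma cycle_probability t (Q : pred nat) :
  P [set x | Q (num_cycles (Pi t x))] = (cycle_law t (fun j => (Q j)%:R))%:E.
Proof.
exact: (discrete_probability P (mPi t) (@crp_states t) (uniq_states t)
  (fun w => Q (num_cycles w))).
Qed.

Lemma num_cycles_trans t a b : trans t.+1 a b != 0 -> 0 < q t a ->
  a \in states t -> (num_cycles a <= num_cycles b)%N.
Proof.
move=> tr /crp_reachable af; rewrite mem_permutations => an.
by have [] := crp_transition_neq0 an af tr.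
Qed.

(** A decrease from [a] to [b] at a given time has probability [q t a * trans t.+1 a b], which
    vanishes because steps only add cycles. The triples [(t, a, b)] are countably many, enumerated
    by [unpickle], so the null sets can be united. *)
Lemma num_cycles_ae_monotone :
  {ae P, forall x, forall t, (num_cycles (Pi t x) <= num_cycles (Pi t.+1 x))%N}.
Proof.
pose good t a b x :=
  Pi t x = a -> Pi t.+1 x = b -> (num_cycles a <= num_cycles b)%N.
have good_ae t a b : {ae P, forall x, good t a b x}.
  have [ab|ab] := leqP (num_cycles a) (num_cycles b).
    by apply: aeW => x _ _.
  exists (Pi t @^-1` [set a] `&` Pi t.+1 @^-1` [set b]); split.
  - exact: measurableI.
  - rewrite joint_two; apply/eqP; rewrite eqe.
    have [->|qa] := eqVneq (q t a) 0; first by rewrite mul0r.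
    have [->|tr] := eqVneq (trans t.+1 a b) 0; first by rewrite mulr0.
    have qa0 : 0 < q t a by rewrite lt_neqAle eq_sym qa pmass_ge0.
    have ain : a \in states t.
      apply: contraT => an; move: qa; rewrite /pmass (_ : _ @^-1` _ = set0).
        by rewrite measure0 eqxx.
      apply/seteqP; split => // x /= Pia; move: an.
      by rewrite -Pia crp_states.
    by have := num_cycles_trans tr qa0 ain; rewrite leqNgt ab.
  - by move=> x /= gx; apply: contrapT => h; apply: gx => Pa Pb; case: h.
have : {ae P, forall x, forall m,
    if unpickle m is Some (t, a, b) then good t a b x else True}.
  apply: ae_foralln => m; case: unpickle => [[[t a] b]|]; last by apply: aeW.
  exact: good_ae.
apply: filterS => x h t; have := h (pickle (t, Pi t x, Pi t.+1 x)).
by rewrite pickleK; apply.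
Qed.

End law.

(** * Sums of independent integer-valued variables *)
Section sum_law.
Context (R : realType) (m : nat -> nat) (p : nat -> nat -> R).

(* Expectation of h under the law of a sum of t independent variables, the s-th
   of which takes the value k with probability p s k for k <= m s. *)
Fixpoint sum_law (t : nat) (h : nat -> R) : R :=
  if t is s.+1 then
    \sum_(k < (m t).+1) p t k * sum_law s (fun j => h (j + k)%N)
  else h 0%N.

Hypothesis p_ge0 : forall t k, 0 <= p t k.
Hypothesis p_sum : forall t, \sum_(k < (m t.+1).+1) p t.+1 k = 1.

Lemma sum_law_lin t a b h h' :
  sum_law t (fun j => a * h j + b * h' j) = a * sum_law t h + b * sum_law t h'.
Proof.
elim: t h h' => //= t IH h h'; rewrite !mulr_sumr -big_split/=.
by apply: eq_bigr => k _; rewrite IH; ring.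
Qed.

Lemma eq_sum_law t h h' : h =1 h' -> sum_law t h = sum_law t h'.
Proof. by move=> /funext ->. Qed.

Lemma sum_law_le t h h' : (forall j, h j <= h' j) -> sum_law t h <= sum_law t h'.
Proof.
elim: t h h' => //= t IH h h' hh'; apply: ler_sum => k _.
by rewrite ler_wpM2l// IH.
Qed.

Lemma sum_law_cst t c : sum_law t (fun=> c) = c.
Proof.
elim: t => //= t IH; rewrite -mulr_suml p_sum mul1r; exact: IH.
Qed.

Lemma sum_law_addc t c h : sum_law t (fun j => h j + c) = sum_law t h + c.
Proof.
have := sum_law_lin t 1 1 h (fun=> c); rewrite !mul1r sum_law_cst => <-.
by apply: eq_sum_law => j; rewrite !mul1r.
Qed.

Lemma sum_law_dist t c h h' : (forall j, `|h j - h' j| <= c) ->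
  `|sum_law t h - sum_law t h'| <= c.
Proof.
move=> hc; have := sum_law_lin t 1 (-1) h h'; rewrite mul1r mulN1r => <-.
rewrite ler_norml -{1}(sum_law_cst t (- c)) -[X in _ && (_ <= X)](sum_law_cst t c).
by apply/andP; split; apply: sum_law_le => j; have := hc j;
  rewrite ler_norml mul1r mulN1r => /andP[].
Qed.

Lemma sum_law_exchange t (r : nat) (w : nat -> R) (g : nat -> nat -> R) :
  \sum_(k < r) w k * sum_law t (g k) = sum_law t (fun j => \sum_(k < r) w k * g k j).
Proof.
elim: r => [|r IH].
  by rewrite big_ord0 (@eq_sum_law _ _ (fun=> 0)) ?sum_law_cst// => j; rewrite big_ord0.
rewrite big_ord_recr/= IH -[X in X + _]mul1r -sum_law_lin.
by apply: eq_sum_law => j; rewrite big_ord_recr/= mul1r.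
Qed.

Definition step_mean t : R := \sum_(k < (m t).+1) p t k * k%:R.
Definition step_var t : R := \sum_(k < (m t).+1) p t k * (k%:R - step_mean t) ^+ 2.
Definition law_mean t : R := \sum_(1 <= s < t.+1) step_mean s.
Definition law_var t : R := \sum_(1 <= s < t.+1) step_var s.

Lemma law_meanS t : law_mean t.+1 = law_mean t + step_mean t.+1.
Proof. by rewrite /law_mean big_nat_recr. Qed.

Lemma law_varS t : law_var t.+1 = law_var t + step_var t.+1.
Proof. by rewrite /law_var big_nat_recr. Qed.

Lemma step_var_ge0 t : 0 <= step_var t.
Proof. by apply: sumr_ge0 => k _; rewrite mulr_ge0// sqr_ge0. Qed.

Lemma step_mean_ge0 t : 0 <= step_mean t.
Proof. by apply: sumr_ge0 => k _; rewrite mulr_ge0. Qed.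

Lemma sum_law_mean t : sum_law t (fun j => j%:R) = law_mean t.
Proof.
elim: t => [|t IH] /=; first by rewrite /law_mean big_geq.
under eq_bigr do under eq_sum_law do rewrite natrD.
under eq_bigr do rewrite sum_law_addc IH mulrDr.
by rewrite big_split/= -mulr_suml p_sum mul1r law_meanS.
Qed.

Lemma step_centered t : \sum_(k < (m t.+1).+1) p t.+1 k * (k%:R - step_mean t.+1) = 0.
Proof.
under eq_bigr do rewrite mulrBr.
by rewrite sumrB -mulr_suml p_sum mul1r subrr.
Qed.

Lemma sum_law_var t : sum_law t (fun j => (j%:R - law_mean t) ^+ 2) = law_var t.
Proof.
elim: t => [|t IH] /=.
  by rewrite /law_mean /law_var !big_geq// subr0 expr0n.
transitivity (\sum_(k < (m t.+1).+1) (p t.+1 k * law_var t +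
    p t.+1 k * (k%:R - step_mean t.+1) ^+ 2)).
  apply: eq_bigr => k _; rewrite -mulrDr; congr (_ * _).
  set c := k%:R - _.
  (* The cross term, with factor [2 * c], has expectation zero because [j%:R - law_mean t] is
     centred. *)
  have E j : ((j + k)%:R - law_mean t.+1) ^+ 2 =
      (1 * (j%:R - law_mean t) ^+ 2 + (2 * c) * (j%:R - law_mean t)) + c ^+ 2.
    rewrite law_meanS natrD /c; ring.
  rewrite (eq_sum_law _ E) sum_law_addc sum_law_lin IH mul1r.
  by rewrite sum_law_addc sum_law_mean subrr mulr0 addr0.
by rewrite big_split/= -mulr_suml p_sum mul1r law_varS.
Qed.

Lemma step_varE t : step_var t.+1 =
  \sum_(k < (m t.+1).+1) p t.+1 k * k%:R ^+ 2 - step_mean t.+1 ^+ 2.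
Proof.
rewrite /step_var; set e := step_mean t.+1.
transitivity (\sum_(k < (m t.+1).+1) (p t.+1 k * k%:R ^+ 2 -
    (p t.+1 k * k%:R * (2 * e) - p t.+1 k * e ^+ 2))).
  by apply: eq_bigr => k _; ring.
rewrite !sumrB -!mulr_suml p_sum -/(step_mean t.+1) -/e; ring.
Qed.

End sum_law.

(** * Moments of the steps *)
Section step_mass.
Context (R : realType) (n : nat -> nat) (theta : R).
Hypothesis theta_gt0 : 0 < theta.

Local Notation p := (step_mass n theta).

Lemma crp_F_gt0 t : 0 < crp_F n theta t.
Proof.
rewrite /crp_F big_ord_recr/= subnn bin0 mul1r.
rewrite ltr_wpDl ?exprn_gt0//; apply: sumr_ge0 => k _.
by rewrite mulr_ge0 ?ler0n ?exprn_ge0 ?ltW.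
Qed.

Lemma step_mass_ge0 t k : 0 <= p t k.
Proof.
rewrite /step_mass divr_ge0 ?(ltW (crp_F_gt0 _))//.
by rewrite mulr_ge0 ?ler0n ?exprn_ge0 ?ltW.
Qed.

Lemma step_mass_sum t : \sum_(k < (n t).+1) p t k = 1.
Proof. by rewrite /step_mass -mulr_suml divff// gt_eqF// crp_F_gt0. Qed.

(** Quotient of consecutive binomial coefficients, cleared of denominators. *)
Lemma step_mass_recr t k : (0 < msize n t.-1)%N -> (k < n t)%N ->
  p t k.+1 * (msize n t.-1 + (n t - k)).-1%:R = p t k * (theta * (n t - k)%:R).
Proof.
rewrite /step_mass; set N := msize n t.-1 => N0 kn.
have -> : (n t - k)%N = (n t - k.+1).+1 by rewrite subnSK.
set r := (n t - k.+1)%N; rewrite addnS /=.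
have E := mul_bin_diag (N + r) r.
have {}E : 'C((N + r).-1, r)%:R * (N + r)%:R = 'C(N + r, r.+1)%:R * r.+1%:R :> R.
  by rewrite -!natrM mulnC E mulnC.
rewrite exprS; set c := 'C((N + r).-1, r)%:R in E *.
set c' := 'C(N + r, r.+1)%:R in E *; set F := crp_F _ _ _.
transitivity (c * (N + r)%:R * theta * theta ^+ k / F); first ring.
rewrite E; ring.
Qed.

(* Ratio of the weights of one new cycle and of no new cycle, up to a factor
   1 + O(1/t). *)
Definition step_rate t : R := theta * (n t)%:R / (msize n t.-1)%:R.

Lemma step_rate_ge0 t : 0 <= step_rate t.
Proof. by rewrite divr_ge0 ?mulr_ge0 ?ler0n ?(ltW theta_gt0). Qed.

(** By the recurrence, each further cycle multiplies the weight by at most [step_rate t], starting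
    from a weight at most 1. *)
Lemma step_mass_le t k : (0 < msize n t.-1)%N -> (k <= n t)%N ->
  p t k <= step_rate t ^+ k.
Proof.
move=> N0; elim: k => [_|k IH kn].
  rewrite expr0 -(step_mass_sum t) big_ord_recl/= lerDl.
  by apply: sumr_ge0 => i _; exact: step_mass_ge0.
set N := msize n t.-1 in N0 *.
have D0 : 0 < (N + (n t - k)).-1%:R :> R by rewrite ltr0n; lia.
rewrite -(ler_pM2r D0) step_mass_recr// exprS.
have le1 : theta * (n t - k)%:R <= step_rate t * (N + (n t - k)).-1%:R.
  have -> : step_rate t * (N + (n t - k)).-1%:R =
      theta * ((n t)%:R * (N + (n t - k)).-1%:R / N%:R).
    by rewrite /step_rate -/N; ring.
  rewrite ler_pM2l// ler_pdivlMr ?ltr0n// -!natrM ler_nat; nia.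
rewrite [leRHS]mulrAC [leLHS]mulrC; apply: ler_pM => //.
- by rewrite mulr_ge0// ltW.
- exact: step_mass_ge0.
- by apply: IH; exact: ltnW.
Qed.

Variable B : nat.
Hypothesis n_le : forall t, (0 < t)%N -> (n t <= B)%N.

(** Bounds the surplus factor [step_rate t ^+ (k - 2)] for [2 <= k <= B]; the added 1 makes the
    powers increase with the exponent. *)
Let M : R := (1 + theta * B%:R) ^+ B.

Lemma step_rate_le t : (0 < t)%N -> (0 < msize n t.-1)%N ->
  step_rate t <= theta * B%:R.
Proof.
move=> t0 N0; rewrite /step_rate -mulrA ler_pM2l//.
rewrite ler_pdivrMr ?ltr0n// -natrM ler_nat.
by rewrite (leq_trans (n_le t0))// leq_pmulr.
Qed.

Lemma step_mass_tail t k : (0 < t)%N -> (0 < msize n t.-1)%N ->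
  (2 <= k <= n t)%N -> p t k <= M * step_rate t ^+ 2.
Proof.
move=> t0 N0 /andP[k2 kn]; apply: le_trans (step_mass_le N0 kn) _.
rewrite -(subnK k2) exprD ler_wpM2r ?exprn_ge0 ?step_rate_ge0//.
have B0 : 0 <= theta * B%:R by rewrite mulr_ge0 ?ler0n// ltW.
apply: (@le_trans _ _ ((1 + theta * B%:R) ^+ (k - 2))).
  rewrite lerXn2r ?nnegrE ?step_rate_ge0 ?addr_ge0//.
  by rewrite (le_trans (step_rate_le t0 N0))// lerDr.
rewrite /M ler_weXn2l ?lerDl//; have := n_le t0; lia.
Qed.

(** The term [theta^-1] pays for replacing the denominator [(N + n t).-1] by [N], the rest for
    replacing [p t 0] by 1. *)
Let D : R := theta^-1 + (1 + B%:R * (M * (theta * B%:R))).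

(** With [al = N / (N + n t - 1)] the recurrence reads [p t 1 = p t 0 * (x * al)]. Both [1 - p t 0]
    and [1 - al] are O(x), so [x - p t 1] is O(x^2). *)
Lemma step_mass1 t : (0 < t)%N -> (0 < msize n t.-1)%N -> (0 < n t)%N ->
  `|p t 1 - step_rate t| <= D * step_rate t ^+ 2.
Proof.
move=> t0 N0 n0; set N := msize n t.-1 in N0 *; set x := step_rate t.
have x0 : 0 <= x := step_rate_ge0 t.
have M1 : 1 <= M by rewrite exprn_ege1// lerDl mulr_ge0 ?ler0n// ltW.
have p1x : p t 1 <= x by have := step_mass_le N0 n0; rewrite expr1.
have p0_le1 : p t 0 <= 1 by have := step_mass_le N0 (leq0n (n t)); rewrite expr0.
(* This is the weight of at least one new cycle: at most [x] for exactly one, while in the tail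
   bound one factor [x] is absorbed into [theta * B%:R]. *)
have p0_ge : 1 - p t 0 <= x * (1 + B%:R * (M * (theta * B%:R))).
  rewrite -[X in X - _](step_mass_sum t) big_ord_recl/= [X in X <= _]addrC addKr.
  have -> : n t = (n t).-1.+1 by lia.
  rewrite big_ord_recl/= /bump/= [leRHS]mulrDr [X in _ <= X + _]mulr1 lerD//.
  apply: (@le_trans _ _ (\sum_(i < (n t).-1) M * x ^+ 2)).
    apply: ler_sum => i _; apply: step_mass_tail => //.
    by have := ltn_ord i; rewrite /bump; lia.
  rewrite sumr_const card_ord -[X in X <= _]mulr_natl.
  have -> : x * (B%:R * (M * (theta * B%:R))) = B%:R * (M * (x * (theta * B%:R))).
    by ring.
  have M0 : 0 <= M := le_trans ler01 M1.
  apply: ler_pM; rewrite ?ler_nat//; first by rewrite mulr_ge0// sqr_ge0.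
    by have := n_le t0; lia.
  by rewrite ler_wpM2l// expr2 ler_wpM2l//; exact: step_rate_le.
have p1 := step_mass_recr N0 n0.
rewrite subn0 -/N in p1.
have P0 := step_mass_ge0 t 0; have th0 := theta_gt0.
have Nm0 : 0 < (N + n t).-1%:R :> R by rewrite ltr0n; lia.
have xN : x * N%:R = theta * (n t)%:R.
  by rewrite /x /step_rate divfK// pnatr_eq0; lia.
have N0R : 0 < N%:R :> R by rewrite ltr0n.
have p1E : p t 1 = p t 0 * (x * (N%:R / (N + n t).-1%:R)).
  apply: (mulIf (lt0r_neq0 Nm0)); rewrite p1 -xN; field.
  exact: lt0r_neq0.
set al := N%:R / (N + n t).-1%:R in p1E.
have al1 : al <= 1 by rewrite ler_pdivrMr// mul1r ler_nat; lia.
have al0 : 0 <= al by rewrite divr_ge0.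
have al_ge : 1 - al <= x * theta^-1.
  rewrite /x /step_rate mulrAC [theta * _]mulrC mulfK ?gt_eqF//.
  have -> : 1 - al = ((N + n t).-1%:R - N%:R) / (N + n t).-1%:R.
    by rewrite mulrBl divff// gt_eqF.
  have -> : (N + n t).-1%:R - N%:R = (n t).-1%:R :> R.
    by rewrite -natrB; [congr (_%:R)|]; lia.
  apply: ler_pM; rewrite ?invr_ge0 ?ler0n// ?ler_nat; first lia.
  by rewrite lef_pV2 ?posrE// ler_nat; lia.
rewrite distrC ger0_norm ?subr_ge0// p1E.
have -> : x - p t 0 * (x * al) = x * (1 - p t 0 * al) by ring.
rewrite expr2 [leRHS]mulrCA ler_wpM2l//.
have -> : 1 - p t 0 * al = (1 - al) + al * (1 - p t 0) by ring.
rewrite /D mulrDl [theta^-1 * x]mulrC lerD//.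
rewrite [X in _ <= X]mulrC; apply: le_trans p0_ge.
by rewrite ler_piMl// subr_ge0.
Qed.

(** With exponent [i.+1] the term [k = 0] vanishes and [k = 1] contributes [p t 1] whatever [i] is,
    so the first two moments share their leading term. *)
Let moment i t : R := \sum_(k < (n t).+1) p t k * k%:R ^+ i.+1.

Lemma step_moment t i : (i <= 1)%N ->
  (0 < t)%N -> (0 < msize n t.-1)%N -> (0 < n t)%N ->
  `|moment i t - step_rate t| <=
    (D + B%:R * (M * B%:R ^+ 2)) * step_rate t ^+ 2.
Proof.
move=> i1 t0 N0 n0; rewrite /moment big_ord_recl/= expr0n mulr0 add0r.
have E : n t = (n t).-1.+1 by lia.
rewrite E big_ord_recl/= /bump/= expr1n mulr1.
rewrite addrAC; apply: le_trans (ler_normD _ _) _.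
rewrite mulrDl lerD ?step_mass1//.
have M0 : 0 <= M by rewrite exprn_ge0// addr_ge0// mulr_ge0// ltW.
have x0 := step_rate_ge0 t.
rewrite ger0_norm; last first.
  by apply: sumr_ge0 => k _; rewrite mulr_ge0 ?step_mass_ge0 ?exprn_ge0.
apply: (@le_trans _ _ (\sum_(k < (n t).-1) M * step_rate t ^+ 2 * B%:R ^+ 2)).
  apply: ler_sum => k _; have kn := ltn_ord k.
  apply: ler_pM; rewrite ?step_mass_ge0 ?exprn_ge0//.
    by apply: step_mass_tail => //; rewrite /bump; lia.
  have B1 : (1 <= B)%N by have := n_le t0; lia.
  apply: (@le_trans _ _ (B%:R ^+ i.+1)).
    by rewrite lerXn2r ?nnegrE// ler_nat; have := n_le t0; rewrite /bump; lia.
  by rewrite ler_weXn2l ?ler1n.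
rewrite sumr_const card_ord -[X in X <= _]mulr_natl.
move: (step_rate t) => x.
have -> : B%:R * (M * B%:R ^+ 2) * x ^+ 2 = B%:R * (M * x ^+ 2 * B%:R ^+ 2) by ring.
rewrite ler_wpM2r//; first by rewrite mulr_ge0 ?sqr_ge0// mulr_ge0 ?sqr_ge0.
by rewrite ler_nat; have := n_le t0; lia.
Qed.

Lemma step_mean_rate : exists2 C, 0 <= C & forall t,
  (0 < t)%N -> (0 < msize n t.-1)%N -> (0 < n t)%N ->
  `|step_mean n p t - step_rate t| <= C * step_rate t ^+ 2.
Proof.
have M0 : 0 <= M by rewrite exprn_ge0// addr_ge0// mulr_ge0// ltW.
have th0 := ltW theta_gt0.
exists (D + B%:R * (M * B%:R ^+ 2)).
  by rewrite !addr_ge0// ?invr_ge0 ?mulr_ge0// ?mulr_ge0// ?exprn_ge0.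
move=> t t0 N0 n0; have := step_moment (leq0n 1) t0 N0 n0.
by rewrite /moment; under eq_bigr do rewrite expr1.
Qed.

(** The second moment equals the rate up to a quadratic error, and the squared mean is at most a
    constant times the squared rate, so it joins the error. *)
Lemma step_var_rate : exists2 C, 0 <= C & forall t,
  (0 < t)%N -> (0 < msize n t.-1)%N -> (0 < n t)%N ->
  `|step_var n p t - step_rate t| <= C * step_rate t ^+ 2.
Proof.
have M0 : 0 <= M by rewrite exprn_ge0// addr_ge0// mulr_ge0// ltW.
have th0 := ltW theta_gt0.
have [C C0 meanC] := step_mean_rate.
have thB : 0 <= theta * B%:R by rewrite mulr_ge0.
exists ((D + B%:R * (M * B%:R ^+ 2)) + (1 + C * (theta * B%:R)) ^+ 2).
  apply: addr_ge0; last by rewrite exprn_ge0// addr_ge0// mulr_ge0.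
  by rewrite !addr_ge0// ?invr_ge0 ?mulr_ge0// ?mulr_ge0// ?exprn_ge0.
move=> t t0 N0 n0; have := step_moment (leqnn 1) t0 N0 n0.
have -> : step_var n p t = moment 1 t - step_mean n p t ^+ 2.
  case: t t0 {N0 n0} => // t _; rewrite step_varE// => s.
  exact: step_mass_sum.
move=> h; rewrite addrAC; apply: le_trans (ler_normD _ _) _.
rewrite mulrDl lerD// normrN ger0_norm ?sqr_ge0//.
have e0 : 0 <= step_mean n p t by apply: step_mean_ge0; exact: step_mass_ge0.
have x0 := step_rate_ge0 t.
have ex : step_mean n p t <= (1 + C * (theta * B%:R)) * step_rate t.
  have := meanC t t0 N0 n0; rewrite ler_norml => /andP[_].
  rewrite lerBlDl => /le_trans; apply; rewrite mulrDl mul1r lerD2l.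
  rewrite -mulrA ler_wpM2l// expr2 ler_wpM2r//; exact: step_rate_le.
by rewrite -exprMn lerXn2r ?nnegrE// mulr_ge0// addr_ge0// mulr_ge0.
Qed.

End step_mass.

(** * Harmonic sums and logarithmic growth *)

Section log_sums.
Context (R : realType).
Implicit Types (x y : nat -> R) (c C D : R).

Lemma ln_le_harmonic t : (0 < t)%N ->
  ln t%:R <= \sum_(1 <= s < t) (s%:R : R)^-1.
Proof.
case: t => // t _; elim: t => [|t IH]; first by rewrite ln1 big_geq.
rewrite big_nat_recr//=; have t0 : 0 < t.+1%:R :> R by rewrite ltr0n.
have -> : t.+2%:R = t.+1%:R * (1 + t.+1%:R^-1) :> R.
  by rewrite mulrDr mulr1 divff ?gt_eqF// -natr1.
rewrite lnM ?posrE ?addr_gt0 ?invr_gt0// lerD//.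
by rewrite le_ln1Dx// (lt_trans (ltrN10 _))// invr_gt0.
Qed.

Lemma harmonic_le_ln t : (0 < t)%N ->
  \sum_(1 <= s < t) (s%:R : R)^-1 <= 1 + ln t%:R.
Proof.
case: t => // t _.
apply: (@le_trans _ _ (\sum_(1 <= s < t.+2) (s%:R : R)^-1)).
  by rewrite [leRHS]big_nat_recr//= lerDl invr_ge0.
elim: t => [|t IH]; first by rewrite big_nat1 invr1 ln1 addr0.
have t0 : 0 < t.+1%:R :> R by rewrite ltr0n.
have t1 : 0 < t.+2%:R :> R by rewrite ltr0n.
(* This is [ln (1 - u) <= - u] at [u = t.+2%:R^-1]. *)
have key : t.+2%:R^-1 <= - (ln t.+1%:R - ln t.+2%:R) :> R.
  rewrite -ln_div ?posrE//.
  have -> : t.+1%:R / t.+2%:R = 1 + (- t.+2%:R^-1) :> R.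
    have -> : t.+1%:R = t.+2%:R - 1 :> R by rewrite -[t.+2%:R]natr1 addrK.
    by field; rewrite gt_eqF.
  by rewrite lerNr le_ln1Dx// ltrN2 invf_lt1// ltr1n.
rewrite big_nat_recr//=; apply: le_trans (lerD IH key) _.
move: (ln t.+1%:R) (ln t.+2%:R) => a b; lra.
Qed.

Lemma sum_inv_sqr t : \sum_(1 <= s < t) (s%:R : R)^-1 ^+ 2 <= 2.
Proof.
case: t => [|t]; first by rewrite big_geq.
apply: (@le_trans _ _ (\sum_(1 <= s < t.+2) (s%:R : R)^-1 ^+ 2)).
  by rewrite [leRHS]big_nat_recr//= lerDl sqr_ge0.
(* Strengthened for the induction: each new term is below the telescoping difference
   [u^-1 - (u + 1)^-1]. *)
suff : \sum_(1 <= s < t.+2) (s%:R : R)^-1 ^+ 2 <= 2 - t.+1%:R^-1.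
  by move/le_trans; apply; rewrite lerBlDr lerDl invr_ge0.
elim: t => [|t IH]; first by rewrite big_nat1 invr1; lra.
rewrite big_nat_recr//=; set u : R := t.+1%:R in IH *.
have u0 : 0 < u by rewrite ltr0n.
have -> : t.+2%:R = u + 1 by rewrite /u natr1.
apply: le_trans (lerD IH (lexx _)) _.
rewrite -subr_ge0.
have -> : 2 - (u + 1)^-1 - (2 - u^-1 + (u + 1)^-1 ^+ 2) = (u * (u + 1) ^+ 2)^-1.
  by field; rewrite !gt_eqF// addr_gt0.
by rewrite invr_ge0 mulr_ge0 ?sqr_ge0// ltW.
Qed.

Lemma log_sum_bounds x y c1 c2 C : 0 <= c1 -> 0 <= C ->
  (forall t, (0 < t)%N -> c1 / t%:R <= x t.+1 <= c2 / t%:R) ->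
  (forall t, (0 < t)%N -> `|y t.+1 - x t.+1| <= C * x t.+1 ^+ 2) ->
  exists D, forall t, (0 < t)%N ->
    c1 * ln t%:R - D <= \sum_(1 <= s < t.+1) y s <= c2 * ln t%:R + D.
Proof.
(* The first step is kept apart and gives [|y 1|]; [c2] covers the excess of the harmonic sum over
   the logarithm; the last term sums the quadratic errors, as inverse squares add up to at most
   2. *)
move=> c1_ge0 C0 xb yx; exists (`|y 1| + c2 + C * c2 ^+ 2 * 2) => t t0.
have c2_ge0 : 0 <= c2.
  have /andP[a b] := xb 1 isT; rewrite !divr1 in a b.
  exact: le_trans c1_ge0 (le_trans a b).
rewrite big_nat_recl//= -[\sum_(1 <= i < t) y i.+1](subrK (\sum_(1 <= i < t) x i.+1)).
rewrite -sumrB.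
have err : `|\sum_(1 <= i < t) (y i.+1 - x i.+1)| <= C * c2 ^+ 2 * 2.
  apply: le_trans (ler_norm_sum _ _ _) _.
  apply: (@le_trans _ _ (\sum_(1 <= i < t) (C * c2 ^+ 2) * (i%:R^-1) ^+ 2)).
    rewrite big_nat [leRHS]big_nat; apply: ler_sum => i /andP[i0 _].
    apply: le_trans (yx i i0) _; rewrite -mulrA ler_wpM2l// -exprMn.
    have /andP[a b] := xb i i0.
    by rewrite lerXn2r ?nnegrE ?(le_trans _ a) ?mulr_ge0// divr_ge0.
  by rewrite -mulr_sumr ler_wpM2l ?sum_inv_sqr// mulr_ge0// sqr_ge0.
have lo : c1 * ln t%:R <= \sum_(1 <= i < t) x i.+1.
  apply: (@le_trans _ _ (\sum_(1 <= i < t) c1 * i%:R^-1)).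
    by rewrite -mulr_sumr ler_wpM2l// ln_le_harmonic.
  by rewrite big_nat [leRHS]big_nat; apply: ler_sum => i /andP[i0 _];
     have /andP[] := xb i i0.
have hi : \sum_(1 <= i < t) x i.+1 <= c2 + c2 * ln t%:R.
  apply: (@le_trans _ _ (\sum_(1 <= i < t) c2 * i%:R^-1)).
    by rewrite big_nat [leRHS]big_nat; apply: ler_sum => i /andP[i0 _];
       have /andP[] := xb i i0.
  rewrite -mulr_sumr -[X in X + _]mulr1 -mulrDr ler_wpM2l//.
  exact: harmonic_le_ln.
have := ler_norm (y 1); have := ler_norm (- y 1); rewrite normrN.
move: err; rewrite ler_norml => /andP[]; lra.
Qed.

Lemma near_ln_ge A : \forall t \near \oo, A <= ln (t%:R : R).
Proof.
near=> t; have tA : expR A <= t%:R by near: t; exact: nbhs_infty_ger.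
by rewrite -[A]expRK ler_ln ?posrE ?expR_gt0// (lt_le_trans (expR_gt0 A)).
Unshelve. all: by end_near. Qed.

Lemma asym_order_ln y c1 c2 D : 0 < c1 -> 0 < c2 ->
  (forall t, (0 < t)%N -> c1 * ln t%:R - D <= y t <= c2 * ln t%:R + D) ->
  asym_order y (fun t => ln t%:R).
Proof.
(* Half of [c1] and the extra 1 absorb [D] once the logarithm exceeds [2 / c1 * D] and [D]. *)
move=> c1_gt0 c2_gt0 yb; exists (c1 / 2), (c2 + 1); split; [lra|lra|].
near=> t; have /andP[a b] : c1 * ln t%:R - D <= y t <= c2 * ln t%:R + D.
  by apply: yb; near: t; exact: nbhs_infty_gt.
have t1 : D <= ln (t%:R : R) by near: t; exact: near_ln_ge.
have t2 : 2 / c1 * D <= ln (t%:R : R) by near: t; exact: near_ln_ge.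
apply/andP; split; last lra.
have : c1 / 2 * (2 / c1 * D) <= c1 / 2 * ln t%:R.
  by rewrite ler_wpM2l// divr_ge0// ltW.
have -> : c1 / 2 * (2 / c1 * D) = D by field; rewrite gt_eqF.
lra.
Unshelve. all: by end_near. Qed.

Lemma asym_equiv_ln y D :
  (forall t, (0 < t)%N -> 1 * ln t%:R - D <= y t <= 1 * ln t%:R + D) ->
  asym_equiv y (fun t => ln t%:R).
Proof.
move=> yb; apply/cvgrPdist_le => e e0; near=> t.
have /andP[a b] : 1 * ln t%:R - D <= y t <= 1 * ln t%:R + D.
  by apply: yb; near: t; exact: nbhs_infty_gt.
have t1 : 1 <= ln (t%:R : R) by near: t; exact: near_ln_ge.
have t2 : D / e <= ln (t%:R : R) by near: t; exact: near_ln_ge.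
have l0 : 0 < ln (t%:R : R) by lra.
have -> : 1 - y t / ln t%:R = (ln t%:R - y t) / ln t%:R by field; rewrite gt_eqF.
rewrite normrM normfV (gtr0_norm l0) ler_pdivrMr//.
rewrite ler_pdivrMr// in t2.
by rewrite ler_norml; apply/andP; split; lra.
Unshelve. all: by end_near. Qed.

End log_sums.

(** * Central limit theorem *)
Section normal_cdf.
Context (R : realType).
Implicit Types x y z h a b c : R.

Local Notation mu := (@lebesgue_measure R).
Local Notation phi := (normal_pdf (0 : R) 1).
Local Notation nprob := (normal_prob (0 : R) 1).

Definition Phi z : R := fine (nprob `]-oo, z]).

Lemma PhiE z : nprob `]-oo, z] = (Phi z)%:E.
Proof. by rewrite /Phi fineK// fin_num_measure. Qed.

Lemma Phi_ge0 z : 0 <= Phi z.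
Proof. by rewrite fine_ge0. Qed.

Lemma Phi_le1 z : Phi z <= 1.
Proof. by rewrite -lee_fin -PhiE probability_le1. Qed.

Lemma Phi_homo : {homo Phi : y z / y <= z}.
Proof.
move=> y z yz; rewrite -lee_fin -!PhiE le_measure ?inE//.
by apply: subset_itvl; rewrite bnd_simp.
Qed.

Lemma Phi_near1 c : 0 < c -> exists z, 1 - c < Phi z.
Proof.
move=> c0; pose F k : set R := [set` `]-oo, (k%:R : R)]].
have Fcvg : nprob (F k) @[k --> \oo] --> 1%E.
  rewrite -(probability_setT nprob).
  have <- : \bigcup_k F k = setT.
    rewrite -subTset => t _/=.
    by exists (Num.truncn t).+1; rewrite //= /F/= in_itv/= ltW// truncnS_gt.
  apply: nondecreasing_cvg_mu.
  + by move=> k; exact: measurable_itv.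
  + by apply: bigcup_measurable => k _; exact: measurable_itv.
  move=> k m km; apply/subsetPset => x/=; rewrite /F/= !in_itv/= => /le_trans.
  by apply; rewrite ler_nat.
have {}Fcvg : Phi k%:R @[k --> \oo] --> (1 : R).
  exact: (fine_cvg Fcvg).
have /cvgrPdist_lt/(_ c c0)[m _ /(_ m (leqnn m))] := Fcvg.
by rewrite /= ltr_norml => /andP[_]; exists m%:R; lra.
Qed.

Lemma Phi_near0 c : 0 < c -> exists z, Phi z < c.
Proof.
move=> c0; pose F k : set R := [set` `]-oo, (- k%:R : R)]].
have Fcvg : nprob (F k) @[k --> \oo] --> 0%E.
  rewrite -(measure0 nprob).
  have <- : \bigcap_k F k = set0.
    rewrite -subset0 => t /(_ (Num.bound t) I).
    rewrite /F/= in_itv/= leNgt => /negP; apply; rewrite ltrNl.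
    by apply: le_lt_trans (ler_norm _) _; rewrite normrN truncnS_gt.
  apply: nonincreasing_cvg_mu.
  + by rewrite (le_lt_trans (probability_le1 _ _)) ?ltry//; exact: measurable_itv.
  + by move=> k; exact: measurable_itv.
  + by apply: bigcapT_measurable => k; exact: measurable_itv.
  + move=> k m km; apply/subsetPset => x/=; rewrite /F/= !in_itv/= => /le_trans.
    by apply; rewrite lerN2 ler_nat.
have {}Fcvg : Phi (- k%:R) @[k --> \oo] --> (0 : R).
  exact: (fine_cvg Fcvg).
have /cvgrPdist_lt/(_ c c0)[m _ /(_ m (leqnn m))] := Fcvg.
by rewrite /= ltr_norml => /andP[? _]; exists (- m%:R); lra.
Qed.

Lemma is_derive_Phi z : is_derive z 1 Phi (phi z).
Proof.
have zu : z < z + 1 by rewrite ltrDl.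
have [] := @continuous_FTC1 R phi -oo%O z (z + 1) zu _ _ _.
- apply: (integrableS _ _ (@subsetT _ _)) => //.
  exact: integrable_normal_pdf.
- by rewrite ltNyr.
- by apply: continuous_normal_pdf; rewrite oner_neq0.
by move=> dz dE; rewrite derive1E in dE; apply: DeriveDef.
Qed.

Lemma phiE z : phi z = normal_peak 1 * expR (- (z ^+ 2 / 2)).
Proof.
by rewrite normal_pdfE ?oner_neq0// /normal_fun subr0 expr1n mulNr.
Qed.

Lemma is_derive_phi z : is_derive z 1 phi (- z * phi z).
Proof.
rewrite (_ : phi = fun z => normal_peak 1 * expR (- (z ^+ 2 / 2))); last first.
  by apply/funext => y; exact: phiE.
by apply: is_derive_eq; rewrite /GRing.scale/=; field.
Qed.

(** Third derivative of [Phi]; its boundedness controls the Taylor remainder in the replacement. *)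
Definition ddphi z : R := (z ^+ 2 - 1) * phi z.

Lemma is_derive_dphi z : is_derive z 1 (fun z => - z * phi z) (ddphi z).
Proof.
have := is_derive_phi z => h.
apply: is_derive_eq; rewrite /ddphi /GRing.scale/=; ring.
Qed.

Lemma phi_ge0 z : 0 <= phi z.
Proof. exact: normal_pdf_ge0. Qed.

Let c0 : R := normal_peak 1.

(** From [1 + x ^+ 2 / 2 <= expR x] at [x = z ^+ 2 / 2]. The quartic weight suffices for all
    polynomial factors of [phi] bounded below. *)
Lemma phi_decay z : phi z * (1 + z ^+ 4 / 8) <= c0.
Proof.
rewrite phiE -mulrA ler_piMr ?normal_peak_ge0//.
rewrite expRN mulrC ler_pdivrMr ?expR_gt0// mul1r.
have := @expR_ge1Dxn R (z ^+ 2 / 2) 1.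
rewrite divr_ge0 ?sqr_ge0// => /(_ isT); apply: le_trans.
have -> : 2`!%:R = 2 :> R by [].
by have -> : (z ^+ 2 / 2) ^+ 2 / 2 = z ^+ 4 / 8 :> R by field.
Qed.

Lemma poly_phi_bound (q : R) z : `|q| <= 2 + z ^+ 4 -> `|q * phi z| <= 8 * c0.
Proof.
move=> qz; rewrite normrM (ger0_norm (phi_ge0 z)) mulrC.
apply: (@le_trans _ _ (phi z * (8 * (1 + z ^+ 4 / 8)))).
  rewrite ler_wpM2l ?phi_ge0//; apply: le_trans qz _.
  by rewrite mulrDr [8 * (_ / 8)]mulrC divfK ?pnatr_eq0// mulr1 lerD2r ler_nat.
by rewrite mulrCA ler_wpM2l// phi_decay.
Qed.

Lemma phi_bound z : `|phi z| <= 8 * c0.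
Proof.
rewrite -[phi z]mul1r; apply: poly_phi_bound; rewrite normr1.
have : 0 <= z ^+ 4 by rewrite exprn_even_ge0.
lra.
Qed.

Lemma dphi_bound z : `|- z * phi z| <= 8 * c0.
Proof.
apply: poly_phi_bound; rewrite normrN.
have -> : z ^+ 4 = `|z| ^+ 4 by rewrite -normrX ger0_norm// exprn_even_ge0.
move: (normr_ge0 z); move: `|z| => u u0.
(* The two squares give [u <= u ^+ 2 + 4^-1 <= u ^+ 4 + 2^-1]. *)
have := sqr_ge0 (u ^+ 2 - 2^-1); have := sqr_ge0 (u - 2^-1).
have -> : (u ^+ 2 - 2^-1) ^+ 2 = u ^+ 4 - u ^+ 2 + 4^-1 by field.
have -> : (u - 2^-1) ^+ 2 = u ^+ 2 - u + 4^-1 by field.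
lra.
Qed.

Lemma ddphi_bound z : `|ddphi z| <= 8 * c0.
Proof.
apply: poly_phi_bound.
have := sqr_ge0 (z ^+ 2 - 2^-1); have := sqr_ge0 z.
have -> : (z ^+ 2 - 2^-1) ^+ 2 = z ^+ 4 - z ^+ 2 + 4^-1 by field.
by rewrite ler_norml; lra.
Qed.

Lemma cube_phi_bound z : `|z ^+ 2 * (- z * phi z)| <= 8 * c0.
Proof.
rewrite mulrA; apply: poly_phi_bound; rewrite mulrN normrN -exprSr normrX.
have -> : z ^+ 4 = `|z| ^+ 4 by rewrite -normrX ger0_norm// exprn_even_ge0.
move: (normr_ge0 z); move: `|z| => u u0.
have u4 : 0 <= u ^+ 4 by rewrite exprn_ge0.
have [u1|u1] := leP u 1.
  have : u ^+ 3 <= 1 by rewrite exprn_ile1.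
  lra.
have : u ^+ 3 <= u ^+ 4 by rewrite ler_weXn2l// ltW.
lra.
Qed.

Lemma mean_value (f df : R -> R) x y :
  (forall z, is_derive z 1 f (df z)) ->
  exists2 z, `|z - x| <= `|y - x| & f y - f x = df z * (y - x).
Proof.
move=> fdf.
have cf u v : {within `[u, v], continuous f}.
  apply: continuous_subspaceT => z.
  by apply: differentiable_continuous; apply/derivable1_diffP; have [] := fdf z.
have [xy|yx|<-] := ltgtP x y.
- have [z zxy ->] := MVT xy (fun z _ => fdf z) (cf x y).
  exists z => //; move: zxy; rewrite in_itv/= => /andP[xz zy].
  by rewrite !gtr0_norm ?subr_gt0// lerD2r ltW.
- have [z zxy E] := MVT yx (fun z _ => fdf z) (cf y x).
  exists z; last by rewrite -opprB E -mulrN opprB.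
  move: zxy; rewrite in_itv/= => /andP[yz zx].
  by rewrite !ltr0_norm ?subr_lt0// lerN2 lerD2r ltW.
- by exists x; rewrite ?subrr ?mulr0.
Qed.

Lemma taylor2 (f f1 f2 : R -> R) x h (M : R) :
  (forall z, is_derive z 1 f (f1 z)) -> (forall z, is_derive z 1 f1 (f2 z)) ->
  (forall z, `|z - x| <= `|h| -> `|f2 z| <= M) ->
  `|f (x + h) - f x - f1 x * h| <= M * h ^+ 2.
Proof.
move=> ff1 f1f2 f2M.
have [y yx ->] := mean_value x (x + h) ff1.
have [z zx E] := mean_value x y f1f2.
rewrite addrAC subrr add0r in yx *.
rewrite -mulrBl E -mulrA normrM; apply: ler_pM => //.
  exact/f2M/(le_trans zx).
by rewrite normrM -[h ^+ 2]real_normK ?num_real// expr2 ler_wpM2r.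
Qed.

(** Mean value theorem for [f] minus its second-order Taylor polynomial at [x]: the derivative of
    the difference is the first-order remainder of [f1], which [taylor2] bounds. *)
Lemma taylor3 (f f1 f2 f3 : R -> R) x h (M : R) :
  (forall z, is_derive z 1 f (f1 z)) -> (forall z, is_derive z 1 f1 (f2 z)) ->
  (forall z, is_derive z 1 f2 (f3 z)) -> (forall z, `|f3 z| <= M) ->
  `|f (x + h) - f x - f1 x * h - f2 x * h ^+ 2 / 2| <= M * `|h| ^+ 3.
Proof.
move=> ff1 f1f2 f2f3 f3M.
pose g u := f u - f1 x * (u - x) - f2 x * (u - x) ^+ 2 / 2.
have gE z : is_derive z 1 g (f1 z - f1 x - f2 x * (z - x)).
  have fz := ff1 z; rewrite /g; apply: is_derive_eq.
  by rewrite /GRing.scale/=; field.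
have [y yx E] := mean_value x (x + h) gE.
have -> : f (x + h) - f x - f1 x * h - f2 x * h ^+ 2 / 2 = g (x + h) - g x.
  by rewrite /g; field.
rewrite E; rewrite addrAC subrr add0r in yx *.
rewrite normrM exprSr mulrA ler_wpM2r//.
have := taylor2 (x := x) (h := y - x) f1f2 f2f3 (fun z _ => f3M z).
rewrite [x + _]addrC subrK => /le_trans; apply.
rewrite ler_wpM2l//; last by rewrite -real_normK ?num_real// lerXn2r ?nnegrE.
by rewrite (le_trans _ (f3M 0)).
Qed.

End normal_cdf.

(** * Replacing one summand by a Gaussian *)

Section lindeberg.
Context (R : realType).
Implicit Types x y z h a b e : R.

Local Notation phi := (normal_pdf (0 : R) 1).

Let M : R := 8 * normal_peak 1.

Let M_ge0 : 0 <= M.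
Proof. by rewrite mulr_ge0// normal_peak_ge0. Qed.

(** Expansion in the scale around 1. The second derivative at [u] is [u ^- 2] times a bounded
    function of [u * z], and [u >= 2^-1] accounts for the factor 4. *)
Lemma Phi_scale z (lam : R) : `|lam - 1| <= 2^-1 ->
  `|Phi (lam * z) - Phi z - z * phi z * (lam - 1)| <= 4 * M * (lam - 1) ^+ 2.
Proof.
move=> lam1.
have dlin (c u : R) : is_derive u 1 (fun u : R => u * c) c.
  by apply: is_derive_eq; rewrite /GRing.scale/= mulr0 add0r mulr1.
have f01 (u : R) : is_derive u 1 (fun u : R => Phi (u * z)) (z * phi (u * z)).
  have h := @is_derive_Phi R (u * z).
  have := @is_derive1_comp R (@Phi R) (fun u : R => u * z) u _ _ h (dlin z u).
  by rewrite mulrC.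
have f12 (u : R) : is_derive u 1 (fun u : R => z * phi (u * z))
    (z * (z * (- (u * z) * phi (u * z)))).
  have h := @is_derive_phi R (u * z).
  have h2 := @is_derive1_comp R phi (fun u : R => u * z) u _ _ h (dlin z u).
  have -> : (fun u : R => z * phi (u * z)) = z *: (phi \o (fun u : R => u * z)).
    by apply/funext.
  by apply: is_derive_eq; rewrite /GRing.scale/= [X in z * X]mulrC.
have := taylor2 (x := 1) (h := lam - 1) f01 f12 (M := 4 * M).
rewrite [1 + _]addrC subrK !mul1r; apply => u.
move=> /le_trans/(_ lam1); rewrite ler_norml => /andP[u1 _].
have u2 : 2^-1 <= u by lra.
have u0 : 0 < u by lra.
have -> : z * (z * (- (u * z) * phi (u * z))) =
    u ^- 2 * ((u * z) ^+ 2 * (- (u * z) * phi (u * z))).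
  by field; rewrite gt_eqF.
rewrite normrM; apply: ler_pM => //; last exact: cube_phi_bound.
have u4 : 4^-1 <= u ^+ 2 by nra.
rewrite normfV ger0_norm ?sqr_ge0// -[4]invrK lef_pV2// posrE ?invr_gt0//.
exact: exprn_gt0.
Qed.

(** Writing [w = q ^+ 2 - 1], the second-order remainder is exactly
    [(q - 1) ^+ 2 * ((q + 2) / (2 * q))], where [q - 1 <= w / 2] and the last factor is at most
    [3 / 2]. *)
Lemma sqrt_ratio (w : R) : 0 <= w <= 1 ->
  `|(Num.sqrt (1 + w))^-1 - 1| <= w / 2 /\
  `|(Num.sqrt (1 + w))^-1 - 1 + w / 2| <= w ^+ 2.
Proof.
move=> /andP[w0 w1]; set q := Num.sqrt (1 + w).
have q1 : 1 <= q by rewrite -[1]sqrtr1 ler_sqrt ?lerDl//; lra.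
have q0 : 0 < q by lra.
have wE : w = q ^+ 2 - 1 by rewrite sqr_sqrtr; lra.
have qw : q - 1 <= w / 2 by rewrite wE; nra.
have iq1 : q^-1 <= 1 by rewrite invf_le1.
have E1 : 1 - q^-1 = (q - 1) * q^-1 by field; rewrite gt_eqF.
split.
  rewrite distrC ger0_norm ?subr_ge0// E1; apply: le_trans qw.
  by rewrite ler_piMr// subr_ge0.
have -> : q^-1 - 1 + w / 2 = (q - 1) ^+ 2 * ((q + 2) / (2 * q)).
  by rewrite wE; field; rewrite gt_eqF.
have q32 : (q + 2) / (2 * q) <= 3 / 2.
  by rewrite ler_pdivrMr ?mulr_gt0//; lra.
have q30 : 0 <= (q + 2) / (2 * q) by rewrite divr_ge0// ?mulr_ge0//; lra.
rewrite ger0_norm; last by rewrite mulr_ge0// sqr_ge0.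
have : (q - 1) ^+ 2 <= (w / 2) ^+ 2 by rewrite lerXn2r ?nnegrE//; lra.
nra.
Qed.

(** With [z = y / s] and [u = v / S], both quantities are compared with [Phi z - z * phi z * u / 2]:
    the average by a Taylor expansion in [xi], the other by rescaling with [lam = (1 + u)^(-1/2)],
    which is [1 - u / 2] up to O(u^2). *)
Lemma swap_step (r : nat) (w xi : nat -> R) (B v S y : R) :
  (forall k, 0 <= w k) -> \sum_(k < r) w k = 1 ->
  \sum_(k < r) w k * xi k = 0 -> \sum_(k < r) w k * xi k ^+ 2 = v ->
  (forall k, (k < r)%N -> `|xi k| <= B) -> 0 < S -> v <= S ->
  `|\sum_(k < r) w k * Phi ((y - xi k) / Num.sqrt S) -
    Phi (y / Num.sqrt (S + v))| <=
  M * (B * v / Num.sqrt S ^+ 3 + 2 * (v / S) ^+ 2).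
Proof.
move=> w_ge0 w1 wxi wxi2 xiB S0 vS; set s := Num.sqrt S.
have s0 : 0 < s by rewrite sqrtr_gt0.
have sS : s ^+ 2 = S by rewrite sqr_sqrtr// ltW.
have v0 : 0 <= v.
  by rewrite -wxi2; apply: sumr_ge0 => k _; rewrite mulr_ge0 ?sqr_ge0.
set z := y / s; pose u := v / S.
have u01 : 0 <= u <= 1.
  by rewrite /u ler_pdivrMr// mul1r vS andbT divr_ge0// ltW.
(* The linear terms cancel because [xi] is centred, the quadratic ones average to [v], and the cubic
   ones are at most [B] times the square, hence [B * v] on average. *)
have Taylor : `|\sum_(k < r) w k * Phi ((y - xi k) / s) -
    (Phi z + (- z * phi z) * u / 2)| <= M * (B * v / s ^+ 3).
  have -> : \sum_(k < r) w k * Phi ((y - xi k) / s) -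
      (Phi z + (- z * phi z) * u / 2) =
      \sum_(k < r) w k * (Phi (z + - xi k / s) - Phi z - phi z * (- xi k / s) -
        (- z * phi z) * (- xi k / s) ^+ 2 / 2).
    transitivity (\sum_(k < r) w k * Phi ((y - xi k) / s) -
      (\sum_(k < r) w k * Phi z - \sum_(k < r) w k * xi k * (phi z / s) +
       \sum_(k < r) w k * xi k ^+ 2 * (- z * phi z / S / 2))).
      rewrite -!mulr_suml w1 wxi wxi2 /u; congr (_ - _); field.
      by rewrite !gt_eqF.
    rewrite -sumrB -big_split/= -sumrB; apply: eq_bigr => k _.
    have -> : (y - xi k) / s = z + - xi k / s by rewrite /z; field; rewrite gt_eqF.
    rewrite -sS; field; rewrite gt_eqF//.
  apply: le_trans (ler_norm_sum _ _ _) _.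
  apply: (@le_trans _ _ (\sum_(k < r) w k * xi k ^+ 2 * (M * B / s ^+ 3))).
    apply: ler_sum => k _; rewrite normrM (ger0_norm (w_ge0 k)) -[leRHS]mulrA ler_wpM2l//.
    apply: le_trans (taylor3 z (- xi k / s) (@is_derive_Phi R) (@is_derive_phi R)
      (@is_derive_dphi R) (@ddphi_bound R)) _.
    rewrite -/M; have -> : M * `|- xi k / s| ^+ 3 = xi k ^+ 2 * (M * `|xi k| / s ^+ 3).
      rewrite normrM normfV (gtr0_norm s0) normrN -[xi k ^+ 2]real_normK ?num_real//.
      by field; rewrite gt_eqF.
    rewrite ler_wpM2l ?sqr_ge0// ler_wpM2r ?invr_ge0 ?exprn_ge0 ?(ltW s0)//.
    by rewrite ler_wpM2l// xiB.
  by rewrite -mulr_suml wxi2 le_eqVlt; apply/orP; left; apply/eqP; ring.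
have [l1 l2] := sqrt_ratio u01.
set lam := (Num.sqrt (1 + u))^-1 in l1 l2.
have lamE : y / Num.sqrt (S + v) = lam * z.
  have -> : S + v = S * (1 + u) by rewrite /u; field; rewrite gt_eqF.
  rewrite sqrtrM ?ltW// -/s /z /lam; field; rewrite !gt_eqF// sqrtr_gt0.
  by case/andP: u01 => ? _; lra.
have lam1 : `|lam - 1| <= 2^-1.
  by apply: le_trans l1 _; case/andP: u01; lra.
have Scale := Phi_scale z lam1.
have Scale2 : `|Phi (lam * z) - (Phi z + (- z * phi z) * u / 2)| <= 2 * M * u ^+ 2.
  have -> : Phi (lam * z) - (Phi z + (- z * phi z) * u / 2) =
      (Phi (lam * z) - Phi z - z * phi z * (lam - 1)) +
      (z * phi z) * (lam - 1 + u / 2) by field.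
  apply: le_trans (ler_normD _ _) _.
  have -> : 2 * M * u ^+ 2 = 4 * M * (u / 2) ^+ 2 + M * u ^+ 2 by field.
  rewrite lerD//.
    apply: le_trans Scale _; apply: ler_wpM2l; first by rewrite mulr_ge0.
    rewrite -[leLHS]real_normK ?num_real// lerXn2r ?nnegrE//.
    by rewrite divr_ge0//; case/andP: u01.
  rewrite normrM ler_pM//; have := dphi_bound z.
  by rewrite mulNr normrN.
rewrite lamE -/u.
rewrite -[X in `|X|](subrKA (Phi z + (- z * phi z) * u / 2)).
apply: le_trans (ler_normD _ _) _; rewrite mulrDr lerD//.
by rewrite distrC mulrA [M * 2]mulrC.
Qed.

End lindeberg.

(** * Iterating the replacement and removing the smoothing *)

Section central_limit.
Context (R : realType) (m : nat -> nat) (p : nat -> nat -> R) (B : nat).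
Hypothesis p_ge0 : forall t k, 0 <= p t k.
Hypothesis p_sum : forall t, \sum_(k < (m t.+1).+1) p t.+1 k = 1.
Hypothesis m_le : forall t, (m t.+1 <= B)%N.

Local Notation L := (sum_law m p).
Local Notation mean := (law_mean m p).
Local Notation var := (law_var m p).
Local Notation e := (step_mean m p).
Local Notation v := (step_var m p).

Let M : R := 8 * normal_peak 1.

Let M_ge0 : 0 <= M.
Proof. by rewrite mulr_ge0// normal_peak_ge0. Qed.

Lemma step_mean_le t : e t.+1 <= B%:R.
Proof.
rewrite -[leRHS]mul1r -[X in _ <= X * _](p_sum t) mulr_suml; apply: ler_sum => k _.
by apply: ler_wpM2l => //; rewrite ler_nat (leq_trans _ (m_le t))// -ltnS.
Qed.

Lemma step_dev_le t k : (k < (m t.+1).+1)%N -> `|k%:R - e t.+1| <= B%:R.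
Proof.
move=> km; have e0 := step_mean_ge0 m p_ge0 t.+1; have eB := step_mean_le t.
have k0 : 0 <= k%:R :> R by [].
have kB : k%:R <= B%:R :> R by rewrite ler_nat (leq_trans _ (m_le t)).
by rewrite ler_norml; apply/andP; split; lra.
Qed.

Lemma step_var_le t : v t.+1 <= B%:R ^+ 2.
Proof.
rewrite -[leRHS]mul1r -[X in _ <= X * _](p_sum t) mulr_suml; apply: ler_sum => k _.
rewrite ler_wpM2l// -real_normK ?num_real// lerXn2r ?nnegrE//.
exact: step_dev_le.
Qed.

(** A variable between 0 and [B] has square at most [B] times itself. Summed over the steps, this
    lets the mean control the variance in Chebyshev's inequality. *)
Lemma step_var_le_mean t : v t.+1 <= B%:R * e t.+1.
Proof.
rewrite step_varE// lerBlDr ler_wpDr ?sqr_ge0//.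
rewrite mulr_sumr; apply: ler_sum => k _; rewrite [leRHS]mulrCA ler_wpM2l// expr2.
by apply: ler_wpM2r => //; rewrite ler_nat (leq_trans _ (m_le t))// -ltnS.
Qed.

Lemma law_var_homo : {homo var : s t / (s <= t)%N >-> s <= t}.
Proof.
apply: homo_leq => // t; first exact: le_trans.
by rewrite law_varS lerDl step_var_ge0.
Qed.

Lemma law_mean_homo : {homo mean : s t / (s <= t)%N >-> s <= t}.
Proof.
apply: homo_leq => // t; first exact: le_trans.
by rewrite law_meanS lerDl step_mean_ge0.
Qed.

Lemma law_var0 : var 0 = 0.
Proof. by rewrite /law_var big_geq. Qed.

Lemma law_mean0 : mean 0 = 0.
Proof. by rewrite /law_mean big_geq. Qed.

Lemma law_var_le_mean t : var t <= B%:R * mean t.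
Proof.
elim: t => [|t IH]; first by rewrite law_var0 law_mean0 mulr0.
by rewrite law_varS law_meanS mulrDr lerD// step_var_le_mean.
Qed.

(* Lindeberg's replacement: (S, y) |-> Phi (y / sqrt S) solves the heat equation
   with generator 1/2 d^2/dy^2, so trading one centered summand of variance v for
   an increase of S by v changes the expectation only by higher-order terms. *)
Lemma law_Phi_swap t (S0 b : R) r : 0 < S0 -> B%:R ^+ 2 <= S0 -> (r <= t)%N ->
  `|L r (fun j => Phi ((b - (j%:R - mean r)) / Num.sqrt (var t - var r + S0))) -
    Phi (b / Num.sqrt (var t + S0))| <=
  M * (B%:R / Num.sqrt S0 ^+ 3 + 2 * B%:R ^+ 2 / S0 ^+ 2) * var r.
Proof.
move=> S00 BS0; elim: r => [_|r IH rt].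
  by rewrite /= law_mean0 law_var0 !subr0 subrr normr0 mulr0.
(* Variance of the Gaussian standing for the summands after [r.+1], together with the initial
   smoothing [S0]; the next replacement adds [v r.+1] to it. *)
set S := var t - var r.+1 + S0.
have S0S : S0 <= S by rewrite lerDr subr_ge0 law_var_homo.
have S_gt0 : 0 < S by apply: lt_le_trans S0S.
have SE : S + v r.+1 = var t - var r + S0.
  by rewrite /S law_varS; ring.
rewrite -(subrKA (L r (fun j => Phi ((b - (j%:R - mean r)) /
  Num.sqrt (S + v r.+1))))).
apply: le_trans (ler_normD _ _) _.
rewrite [X in _ <= _ * X]law_varS mulrDr addrC SE lerD ?IH ?(ltnW rt)//.
rewrite [L r.+1 _]/= (@sum_law_exchange R m p p_sum r (m r.+1).+1 (p r.+1)
  (fun k j => Phi ((b - ((j + k)%:R - mean r.+1)) / Num.sqrt S))).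
apply: sum_law_dist => // j.
have E (k : nat) : (b - ((j + k)%:R - mean r.+1)) =
    (b - (j%:R - mean r)) - (k%:R - e r.+1).
  by rewrite law_meanS natrD; ring.
under eq_bigr do rewrite E.
rewrite -SE.
apply: le_trans (swap_step (B := B%:R) _ (p_ge0 r.+1) (p_sum r)
  (step_centered p_sum r) erefl (@step_dev_le r) S_gt0 _) _.
  apply: le_trans (step_var_le r) _; exact: le_trans S0S.
rewrite -[leRHS]mulrA ler_wpM2l// [leRHS]mulrDl -/(v r.+1).
have v0 : 0 <= v r.+1 by exact: step_var_ge0.
rewrite lerD//.
  rewrite mulrAC ler_wpM2r// ler_wpM2l// lef_pV2 ?posrE ?exprn_gt0 ?sqrtr_gt0//.
  by rewrite lerXn2r ?nnegrE ?sqrtr_ge0// ler_sqrt// ltW.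
have -> : 2 * (v r.+1 / S) ^+ 2 = (2 * v r.+1 / S ^+ 2) * v r.+1.
  by field; rewrite gt_eqF.
apply: ler_wpM2r => //; apply: ler_pM.
- by rewrite mulr_ge0.
- by rewrite invr_ge0 sqr_ge0.
- by rewrite ler_wpM2l// step_var_le.
- by rewrite lef_pV2 ?posrE ?exprn_gt0// lerXn2r ?nnegrE ?(ltW S00) ?(ltW S_gt0).
Qed.

Local Notation sd t := (Num.sqrt (var t)).

Hypothesis var_infty : forall A, \forall t \near \oo, A <= var t.

(** In units of the standard deviation [s], smoothing at scale [eps] means [S0 = (eps * s) ^+ 2].
    The replacement error, multiplied by the total variance [s ^+ 2], is then
    [C1 / s + C2 / s ^+ 2], which tends to 0. *)
Lemma smoothed_clt (a eps : R) : 0 < eps ->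
  L t (fun j => Phi ((a - (j%:R - mean t) / sd t) / eps)) @[t --> \oo] -->
  Phi (a / Num.sqrt (1 + eps ^+ 2)).
Proof.
move=> eps0; apply/cvgrPdist_le => d d0.
pose C1 := M * (B%:R / eps ^+ 3); pose C2 := M * (2 * B%:R ^+ 2 / eps ^+ 4).
have C10 : 0 <= C1 by apply: mulr_ge0 => //; rewrite divr_ge0 ?exprn_ge0 ?(ltW eps0).
have C20 : 0 <= C2.
  by apply: mulr_ge0 => //; rewrite divr_ge0 ?exprn_ge0 ?(ltW eps0) ?mulr_ge0 ?sqr_ge0.
near=> t.
have V1 : 1 <= var t by near: t; exact: var_infty.
have VB : B%:R ^+ 2 / eps ^+ 2 <= var t by near: t; exact: var_infty.
have VC : ((C1 + C2) / d) ^+ 2 <= var t by near: t; exact: var_infty.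
have V0 : 0 < var t by lra.
set s := sd t; have sV : s ^+ 2 = var t by rewrite sqr_sqrtr// ltW.
have s0 : 0 < s by rewrite sqrtr_gt0.
have s1 : 1 <= s by rewrite -[leLHS]sqrtr1 ler_sqrt// ltW.
have sC : (C1 + C2) / d <= s.
  by rewrite -[leLHS]ger0_norm ?divr_ge0 ?addr_ge0 ?(ltW d0)// -sqrtr_sqr ler_sqrt// ltW.
rewrite ler_pdivrMr// in sC.
pose S0 := (eps * s) ^+ 2.
have S00 : 0 < S0 by rewrite exprn_gt0// mulr_gt0.
have sS0 : Num.sqrt S0 = eps * s by rewrite sqrtr_sqr gtr0_norm// mulr_gt0.
have BS0 : B%:R ^+ 2 <= S0.
  by rewrite /S0 exprMn mulrC -ler_pdivrMr ?exprn_gt0// sV.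
have := law_Phi_swap (a * s) S00 BS0 (leqnn t).
have E0 : Phi (a * s / Num.sqrt (var t + S0)) = Phi (a / Num.sqrt (1 + eps ^+ 2)).
  have -> : var t + S0 = (1 + eps ^+ 2) * var t by rewrite /S0 -sV; ring.
  have q0 : 0 < Num.sqrt (1 + eps ^+ 2).
    by rewrite sqrtr_gt0 addr_gt0// exprn_gt0.
  rewrite sqrtrM ?addr_ge0 ?sqr_ge0// -/s; congr Phi; field.
  by rewrite !gt_eqF.
rewrite E0 subrr add0r sS0.
have -> : L t (fun j => Phi ((a * s - (j%:R - mean t)) / (eps * s))) =
    L t (fun j => Phi ((a - (j%:R - mean t) / s) / eps)).
  apply: eq_sum_law => j; congr Phi; field; rewrite !gt_eqF//.
rewrite distrC => /le_trans; apply.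
have -> : M * (B%:R / (eps * s) ^+ 3 + 2 * B%:R ^+ 2 / S0 ^+ 2) * var t =
    C1 / s + C2 / s ^+ 2.
  by rewrite /S0 -sV /C1 /C2; field; rewrite !gt_eqF.
apply: (@le_trans _ _ ((C1 + C2) / s)); last by rewrite ler_pdivrMr// mulrC.
rewrite mulrDl lerD2l ler_wpM2l// lef_pV2 ?posrE ?exprn_gt0//.
by rewrite expr2 ler_peMr// ltW.
Unshelve. all: by end_near. Qed.

Lemma Phi_lipschitz (x y : R) : `|Phi y - Phi x| <= M * `|y - x|.
Proof.
have [z _ ->] := mean_value x y (@is_derive_Phi R).
by rewrite normrM ler_wpM2r// phi_bound.
Qed.

Lemma inv_sqrt_dist (eps : R) : 0 < eps <= 1 ->
  `|(Num.sqrt (1 + eps ^+ 2))^-1 - 1| <= eps.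
Proof.
move=> /andP[e0 e1].
have [] := @sqrt_ratio R (eps ^+ 2); first by rewrite sqr_ge0 expr_le1// ltW.
by move=> h _; apply: le_trans h _; nra.
Qed.

(* As eps -> 0 and dl / eps -> oo, the smoothed indicators at x - dl and x + dl
   sandwich the indicator of ]-oo, x] up to the tails of the Gaussian. *)
Lemma sum_law_clt (x : R) :
  L t (fun j => ((j%:R - mean t) / sd t <= x)%R%:R) @[t --> \oo] --> Phi x.
Proof.
apply/cvgrPdist_le => d d0.
pose d1 := d / 8; have d10 : 0 < d1 by rewrite divr_gt0.
pose dl := d1 / (M + 1); have dl0 : 0 < dl by rewrite divr_gt0// ltr_wpDl.
have [z1 z1P] := Phi_near1 d10; have [z0 z0P] := Phi_near0 d10.
(* [A] will equal [dl / eps]. Its terms ensure in turn that [dl / eps] lies beyond the Gaussian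
   quantiles [z1] and [z0], that rescaling costs at most [d1], and that [eps <= 1]. *)
pose extra := dl * (M * (`|x| + dl)) / d1.
pose A := 1 + `|z1| + `|z0| + extra + dl.
have extra0 : 0 <= extra.
  by rewrite divr_ge0 ?(ltW d10)// mulr_ge0 ?(ltW dl0)// mulr_ge0 ?addr_ge0 ?(ltW dl0).
have A0 : 0 < A by rewrite /A; have := normr_ge0 z1; have := normr_ge0 z0; lra.
pose eps := dl / A.
have eps0 : 0 < eps by rewrite divr_gt0.
have dlA : dl / eps = A by rewrite /eps; field; rewrite !gt_eqF.
have z1A : z1 <= dl / eps.
  rewrite dlA; apply: le_trans (ler_norm _) _; rewrite /A.
  have := normr_ge0 z0; lra.
have z0A : - (dl / eps) <= z0.
  rewrite dlA lerNl; apply: le_trans (ler_norm _) _; rewrite normrN /A.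
  have := normr_ge0 z1; lra.
have eps1 : 0 < eps <= 1.
  rewrite eps0 /= ler_pdivrMr// mul1r /A.
  have := normr_ge0 z1; have := normr_ge0 z0; lra.
have epsM : M * ((`|x| + dl) * eps) <= d1.
  have -> : M * ((`|x| + dl) * eps) = dl * (M * (`|x| + dl)) / A.
    by rewrite /eps; ring.
  rewrite ler_pdivrMr// [leRHS]mulrC -ler_pdivrMr// -/extra /A.
  have := normr_ge0 z1; have := normr_ge0 z0; lra.
have Mdl : M * dl <= d1.
  rewrite /dl mulrA ler_pdivrMr ?ltr_wpDl// mulrC ler_wpM2l ?lerDl//; exact: ltW.
(* The smoothed limit differs from [Phi x] by a shift and a rescaling, each costing at most [d1]. *)
have center c : `|c| <= dl ->
    `|Phi ((x + c) / Num.sqrt (1 + eps ^+ 2)) - Phi x| <= d1 + d1.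
  move=> c_le; apply: le_trans (Phi_lipschitz _ _) _; set q := _^-1.
  have -> : (x + c) * q - x = (x + c) * (q - 1) + c by ring.
  apply: (@le_trans _ _ (M * ((`|x| + dl) * eps + dl))); last first.
    by rewrite mulrDr lerD.
  rewrite ler_wpM2l//; apply: le_trans (ler_normD _ _) _; rewrite lerD//.
  rewrite normrM; apply: ler_pM => //; last exact: inv_sqrt_dist.
  by apply: le_trans (ler_normD _ _) _; rewrite lerD2l.
have /cvgrPdist_le/(_ d1 d10) smooth_hi := @smoothed_clt (x + dl) eps eps0.
have /cvgrPdist_le/(_ d1 d10) smooth_lo := @smoothed_clt (x - dl) eps eps0.
near=> t.
have hi : `|Phi ((x + dl) / Num.sqrt (1 + eps ^+ 2)) -
    L t (fun j => Phi ((x + dl - (j%:R - mean t) / sd t) / eps))| <= d1.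
  by near: t.
have lo : `|Phi ((x - dl) / Num.sqrt (1 + eps ^+ 2)) -
    L t (fun j => Phi ((x - dl - (j%:R - mean t) / sd t) / eps))| <= d1.
  by near: t.
have hi_c : `|Phi ((x + dl) / Num.sqrt (1 + eps ^+ 2)) - Phi x| <= d1 + d1.
  by apply: center; rewrite gtr0_norm.
have lo_c : `|Phi ((x - dl) / Num.sqrt (1 + eps ^+ 2)) - Phi x| <= d1 + d1.
  by apply: center; rewrite normrN gtr0_norm.
(* When the indicator is 1, the argument of [Phi] is at least [dl / eps], where [Phi] exceeds
   [1 - d1]; the lower bound uses the other tail. *)
have ind_hi : L t (fun j => ((j%:R - mean t) / sd t <= x)%R%:R) <=
    L t (fun j => Phi ((x + dl - (j%:R - mean t) / sd t) / eps)) + d1.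
  rewrite -sum_law_addc//; apply: sum_law_le => // j; set Y := _ / sd t.
  have [Yx|xY] := leP Y x; last by rewrite addr_ge0 ?Phi_ge0// ltW.
  have : Phi z1 <= Phi ((x + dl - Y) / eps).
    apply: Phi_homo; apply: le_trans z1A _.
    by rewrite ler_pM2r ?invr_gt0//; lra.
  by rewrite /=; lra.
have ind_lo : L t (fun j => Phi ((x - dl - (j%:R - mean t) / sd t) / eps)) <=
    L t (fun j => ((j%:R - mean t) / sd t <= x)%R%:R) + d1.
  rewrite -sum_law_addc//; apply: sum_law_le => // j; set Y := _ / sd t.
  have [Yx|xY] := leP Y x.
    by have := Phi_le1 ((x - dl - Y) / eps); rewrite /=; lra.
  have : Phi ((x - dl - Y) / eps) <= Phi z0.
    apply: Phi_homo; apply: le_trans z0A; rewrite -[leRHS]mulNr.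
    by rewrite ler_pM2r ?invr_gt0//; lra.
  by rewrite /=; lra.
have dE : d = d1 * 8 by rewrite /d1 divfK.
move: hi lo hi_c lo_c; rewrite !ler_norml.
move=> /andP[? ?] /andP[? ?] /andP[? ?] /andP[? ?]; apply/andP; split; lra.
Unshelve. all: by end_near. Qed.

End central_limit.

(** * Strong law *)
Section subsequence.
Context (R : realType) (E : nat -> R) (B : R).
Hypothesis E0 : E 0%N = 0.
Hypothesis B_ge0 : 0 <= B.
Hypothesis E_homo : {homo E : s t / (s <= t)%N >-> s <= t}.
Hypothesis E_step : forall t, E t.+1 <= E t + B.
Hypothesis E_infty : forall A, \forall t \near \oo, A <= E t.

Lemma hitting_exists (j : nat) : exists t, j%:R ^+ 2 <= E t.
Proof. by have [t _ /(_ t (leqnn t))] := E_infty (j%:R ^+ 2); exists t. Qed.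

Definition hitting j : nat := ex_minn (hitting_exists j).

Lemma hitting_ge j : j%:R ^+ 2 <= E (hitting j).
Proof. by rewrite /hitting; case: ex_minnP. Qed.

Lemma hitting_min j t : j%:R ^+ 2 <= E t -> (hitting j <= t)%N.
Proof. by move=> jt; rewrite /hitting; case: ex_minnP => s _; apply. Qed.

(** One time earlier the square was not yet reached, and a single step adds at most [B]; a hitting
    time 0 is covered by [E 0 = 0]. *)
Lemma hitting_le j : E (hitting j) <= j%:R ^+ 2 + B.
Proof.
case h : (hitting j) => [|t]; first by rewrite E0 addr_ge0 ?sqr_ge0.
apply: le_trans (E_step t) _; rewrite lerD2r leNgt; apply/negP => jt.
by have := hitting_min (ltW jt); rewrite h ltnn.
Qed.

(* Between two consecutive hitting times of squares, E varies by a factor that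
   tends to 1, so monotonicity carries the limit over to all times. *)
Lemma subsequence_ratio (k : nat -> R) :
  {homo k : s t / (s <= t)%N >-> s <= t} ->
  (forall e, 0 < e -> exists J, forall j, (J <= j)%N ->
     `|k (hitting j) - E (hitting j)| <= e * E (hitting j)) ->
  asym_equiv k E.
Proof.
move=> k_homo kE; apply/cvgrPdist_le => e e0.
pose d := Num.min 1 (e / 2).
have d0 : 0 < d by rewrite lt_min ltr01 divr_gt0.
have d1 : d <= 1 by rewrite ge_min lexx.
have de : d + d <= e.
  have : d <= e / 2 by rewrite ge_min lexx orbT.
  lra.
have [J Jd] := kE d d0.
(* Beyond this index the gap [2 * u + 1 + B] between consecutive levels is at most half of
   [d * u ^+ 2]. *)
pose J2 := maxn J.+1 (Num.truncn (2 * (3 + B) / d)).+1.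
near=> t; have EJ : (J2.+1)%:R ^+ 2 <= E t by near: t; exact: E_infty.
have Et0 : 0 < E t by apply: lt_le_trans EJ; rewrite exprn_gt0.
(* The level for which [t] lies between [hitting j] and [hitting j.+1]. *)
pose j := Num.truncn (Num.sqrt (E t)).
have sE : Num.sqrt (E t) ^+ 2 = E t by rewrite sqr_sqrtr// ltW.
have jE : j%:R ^+ 2 <= E t.
  by rewrite -sE lerXn2r ?nnegrE ?sqrtr_ge0// truncn_le ?sqrtr_ge0.
have Ej : E t < j.+1%:R ^+ 2.
  by rewrite -sE ltr_pXn2r ?nnegrE ?sqrtr_ge0// truncnS_gt.
have J2j : (J2 <= j)%N.
  rewrite -ltnS -(ltr_nat R) -(@ltr_pXn2r _ 2) ?nnegrE//.
  apply: le_lt_trans Ej; apply: le_trans EJ.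
  by rewrite lerXn2r ?nnegrE// ler_nat.
have Jj : (J <= j)%N by apply: leq_trans J2j; rewrite leq_max leqnSn.
have tj : (hitting j <= t)%N by exact: hitting_min.
have tj1 : (t <= hitting j.+1)%N.
  rewrite leqNgt; apply/negP => /ltnW/E_homo/(le_trans (hitting_ge _)).
  by rewrite leNgt Ej.
have lo := Jd j Jj; have hi := Jd j.+1 (leqW Jj).
have kt := k_homo _ _ tj; have tk := k_homo _ _ tj1.
have h1 := hitting_ge j; have h2 := hitting_le j.+1.
set u : R := j%:R in h1 jE *.
have j1u : j.+1%:R = u + 1 by rewrite /u natr1.
rewrite j1u in h2 Ej.
have u1 : 1 <= u by rewrite /u ler1n (leq_trans _ J2j)// leq_max.
have uB : 2 * (3 + B) <= d * u.
  rewrite [leRHS]mulrC -ler_pdivrMr//; apply: le_trans (ltW (truncnS_gt _)) _.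
  by rewrite ler_nat; apply: leq_trans J2j; rewrite leq_max leqnn orbT.
clearbody u; have B0 := B_ge0.
have uB2 : 2 * (2 * u + 1 + B) <= d * u ^+ 2.
  have Bu : 0 <= B * (u - 1) by rewrite mulr_ge0// subr_ge0.
  apply: (@le_trans _ _ (2 * (3 + B) * u)); first nra.
  rewrite [leRHS](_ : _ = d * u * u); last by ring.
  apply: ler_wpM2r uB; lra.
have lo' : (1 - d) * u ^+ 2 <= k (hitting j).
  apply: (@le_trans _ _ ((1 - d) * E (hitting j))).
    by rewrite ler_wpM2l// subr_ge0.
  by move: lo; rewrite ler_norml => /andP[]; lra.
have hi' : k (hitting j.+1) <= (1 + d) * ((u + 1) ^+ 2 + B).
  apply: (@le_trans _ _ ((1 + d) * E (hitting j.+1))); last first.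
    by rewrite ler_wpM2l//; lra.
  by move: hi; rewrite ler_norml => /andP[]; lra.
have -> : 1 - k t / E t = (E t - k t) / E t by field; rewrite gt_eqF.
rewrite normrM normfV (gtr0_norm Et0) ler_pdivrMr//.
apply: (@le_trans _ _ ((d + d) * u ^+ 2)); last first.
  apply: ler_pM => //; [lra|exact: sqr_ge0].
(* [w] bounds the variation of [E] between the two hitting times and [v] is the allowed error; in
   these terms only linear inequalities remain. *)
pose w : R := 2 * u + 1 + B; pose v : R := d * u ^+ 2.
have w0 : 0 <= w by rewrite /w; lra.
have dw : d * w <= w by rewrite ler_piMl.
have v0 : 0 <= v by rewrite mulr_ge0 ?sqr_ge0// ltW.
have hiE : (1 + d) * ((u + 1) ^+ 2 + B) = u ^+ 2 + w + v + d * w.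
  by rewrite /w /v; ring.
have loE : (1 - d) * u ^+ 2 = u ^+ 2 - v by rewrite /v; ring.
have EjE : (u + 1) ^+ 2 = u ^+ 2 + w - B by rewrite /w; ring.
rewrite hiE in hi'; rewrite loE in lo'; rewrite EjE in Ej.
rewrite -/w -/v in uB2; rewrite mulrDl -/v.
clear - hi' lo' Ej uB2 jE kt tk B0 w0 dw v0.
by rewrite ler_norml; apply/andP; split; lra.
Unshelve. all: by end_near. Qed.

End subsequence.

(** * Borel-Cantelli with inverse square bounds *)

Section almost_sure.
Context (R : realType) (d : measure_display) (T : measurableType d).
Context (P : probability T R).

Lemma borel_cantelli_sqr (F : nat -> set T) (C : R) :
  (forall j, measurable (F j)) ->
  (forall j, (P (F j) <= (C * (j.+1%:R^-1) ^+ 2)%:E)%E) ->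
  {ae P, forall x, exists J, forall j, (J <= j)%N -> ~ F j x}.
Proof.
move=> mF FC.
have C0 : 0 <= C.
  have := le_trans (measure_ge0 P (F 0%N)) (FC 0%N).
  by rewrite lee_fin invr1 expr1n mulr1.
have P0 : P (lim_sup_set F) = 0%E.
  apply: lim_sup_set_cvg0 => //; apply: (@le_lt_trans _ _ (C * 2)%:E); last exact: ltry.
  apply: lime_le; first exact: is_cvg_nneseries.
  apply: nearW => k; apply: (@le_trans _ _
    (\sum_(0 <= j < k) (C * (j.+1%:R^-1) ^+ 2)%:E)%E).
    by apply: lee_sum => j _; exact: FC.
  rewrite sumEFin lee_fin -mulr_sumr ler_wpM2l//.
  have := sum_inv_sqr R k.+1; rewrite big_add1 /=; exact.
exists (lim_sup_set F); split => //.
  apply: bigcapT_measurable => k; apply: bigcup_measurable => j _; exact: mF.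
move=> x /= nx k _; apply: contrapT => nk; apply: nx; exists k => j kj Fx.
by apply: nk; exists j.
Qed.

End almost_sure.

(** * Conclusion *)
Section crp_asymptotics.
Context (R : realType) (d : measure_display) (T : measurableType d).
Context (P : probability T R) (n : nat -> nat) (theta : R).
Context (Pi : nat -> T -> seq nat).
Hypothesis n_ge1 : forall i, (1 <= i)%N -> (1 <= n i)%N.
Hypothesis theta_gt0 : 0 < theta.
Hypothesis crpPi : is_multiset_crp P n theta Pi.

Local Notation p := (step_mass n theta).
Local Notation E := (law_mean n p).
Local Notation V := (law_var n p).

Let p_ge0 t k : 0 <= p t k.
Proof. exact: step_mass_ge0. Qed.

Let p_sum t : \sum_(k < (n t.+1).+1) p t.+1 k = 1.
Proof. exact: step_mass_sum. Qed.

Lemma cycle_lawE t h : cycle_law P n Pi t h = sum_law n p t h.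
Proof.
elim: t h => [|t IH] h; first by rewrite (cycle_law0 crpPi).
by rewrite (cycle_law_recr crpPi)/=; apply: eq_bigr => k _; rewrite IH.
Qed.

Lemma mean_crp_K t : mean P (crp_K R Pi t) = E t.
Proof.
have := cycle_expectation crpPi t (fun j => j%:R).
by rewrite /mean /crp_K => ->; rewrite cycle_lawE sum_law_mean.
Qed.

Lemma var_crp_K t : Defs.var P (crp_K R Pi t) = V t.
Proof.
have := cycle_expectation crpPi t (fun j => (j%:R - E t) ^+ 2).
rewrite cycle_lawE sum_law_var// => VE.
rewrite /Defs.var /variance covariance.unlock.
rewrite -/(mean P (crp_K R Pi t)) mean_crp_K -[RHS]/(fine (V t)%:E) -VE.
by congr (fine (expectation P _)).
Qed.

Lemma msize_ge t : (t <= msize n t)%N.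
Proof.
elim: t => // t IH; rewrite /msize big_nat_recr//= -/(msize n t).
by have := n_ge1 (ltn0Sn t); lia.
Qed.

Section bounded.
Variable B : nat.
Hypothesis n_le : forall i, (1 <= i)%N -> (n i <= B)%N.

Lemma msize_le t : (msize n t <= B * t)%N.
Proof.
elim: t => [|t IH]; first by rewrite /msize big_geq.
by rewrite /msize big_nat_recr//= mulnS addnC leq_add// n_le.
Qed.

(** The total size satisfies [t <= msize n t <= B * t], and [n t.+1] lies between 1 and [B]. *)
Lemma step_rate_bounds t : (0 < t)%N ->
  theta / B%:R / t%:R <= step_rate n theta t.+1 <= theta * B%:R / t%:R.
Proof.
move=> t0; rewrite /step_rate /=.
have B0 : (0 < B)%N by rewrite (leq_trans (n_ge1 (isT : (1 <= 1)%N)))// n_le.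
have N0 : (0 < msize n t)%N by rewrite (leq_trans t0)// msize_ge.
apply/andP; split; rewrite -!mulrA ler_pM2l//.
  rewrite -invfM -natrM -[leLHS]mul1r ler_pM ?invr_ge0 ?ler0n//.
    by rewrite ler1n n_ge1.
  by rewrite lef_pV2 ?posrE ?ltr0n ?muln_gt0 ?B0// ler_nat msize_le.
rewrite ler_pM ?invr_ge0 ?ler0n// ?ler_nat ?n_le//.
by rewrite lef_pV2 ?posrE ?ltr0n// ler_nat msize_ge.
Qed.

Lemma law_log_bounds c1 c2 : 0 <= c1 ->
  (forall t, (0 < t)%N -> c1 / t%:R <= step_rate n theta t.+1 <= c2 / t%:R) ->
  exists D, forall t, (0 < t)%N ->
    (c1 * ln t%:R - D <= E t <= c2 * ln t%:R + D) /\
    (c1 * ln t%:R - D <= V t <= c2 * ln t%:R + D).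
Proof.
move=> c1_ge0 rate.
have side t : (0 < t)%N ->
    [/\ (0 < t.+1)%N, (0 < msize n t)%N & (0 < n t.+1)%N].
  by move=> t0; split; rewrite ?n_ge1// (leq_trans t0)// msize_ge.
have [C C0 meanC] := step_mean_rate theta_gt0 n_le.
have [C' C'0 varC] := step_var_rate theta_gt0 n_le.
have [t0|D1 D1P] := log_sum_bounds c1_ge0 C0 rate (y := step_mean n p).
  by move=> /side[? ? ?]; exact: meanC.
have [t0|D2 D2P] := log_sum_bounds c1_ge0 C'0 rate (y := step_var n p).
  by move=> /side[? ? ?]; exact: varC.
exists (Num.max D1 D2) => t t0.
have /andP[a b] := D1P t t0; have /andP[a' b'] := D2P t t0.
have m1 : D1 <= Num.max D1 D2 by rewrite le_max lexx.
have m2 : D2 <= Num.max D1 D2 by rewrite le_max lexx orbT.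
split; apply/andP; split; rewrite /law_mean /law_var; lra.
Qed.

Let B_gt0 : (0 < B)%N.
Proof. by rewrite (leq_trans (n_ge1 (isT : (1 <= 1)%N)))// n_le. Qed.

Lemma law_order :
  asym_order E (fun t => ln t%:R) /\ asym_order V (fun t => ln t%:R).
Proof.
have c1_gt0 : 0 < theta / B%:R by rewrite divr_gt0// ltr0n.
have c2_gt0 : 0 < theta * B%:R by rewrite mulr_gt0// ltr0n.
have [D DP] := law_log_bounds (ltW c1_gt0) step_rate_bounds.
split; apply: (@asym_order_ln _ _ _ _ D c1_gt0 c2_gt0) => t t0; by have [] := DP t t0.
Qed.

Lemma asym_order_infty (y : nat -> R) : asym_order y (fun t => ln t%:R) ->
  forall A, \forall t \near \oo, A <= y t.
Proof.
move=> [c1 [c2 [c1_gt0 _ yb]]] A; near=> t.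
have /andP[h _] : c1 * ln t%:R <= y t <= c2 * ln t%:R by near: t.
apply: le_trans h; rewrite -ler_pdivrMl//.
by near: t; exact: near_ln_ge.
Unshelve. all: by end_near. Qed.

Let E_infty A : \forall t \near \oo, A <= E t.
Proof. by apply: asym_order_infty; have [] := law_order. Qed.

Let V_infty A : \forall t \near \oo, A <= V t.
Proof. by apply: asym_order_infty; have [] := law_order. Qed.

Let m_le t : (n t.+1 <= B)%N.
Proof. exact: n_le. Qed.

(** Chebyshev's inequality, read off the law of the sum: [c ^+ 2] times the indicator is at most the
    squared deviation. *)
Lemma crp_chebyshev t (c : R) : 0 < c ->
  (P [set x | (c <= `|crp_K R Pi t x - E t|)%R] <= (V t / c ^+ 2)%:E)%E.
Proof.
move=> c0.
have -> := cycle_probability crpPi t (fun j => c <= `|j%:R - E t|).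
rewrite lee_fin cycle_lawE -(sum_law_var p_sum) ler_pdivlMr ?exprn_gt0//.
have := sum_law_lin n p t (c ^+ 2) 0 (fun j => (c <= `|j%:R - E t|)%R%:R) (fun=> 0).
rewrite !mul0r addr0 mulrC => <-.
apply: sum_law_le => // j; rewrite addr0.
have [cj|_] := leP c `|j%:R - E t|; rewrite /= ?mulr0 ?sqr_ge0// mulr1.
by rewrite -[leRHS]real_normK ?num_real// lerXn2r ?nnegrE// ltW.
Qed.

(** At the hitting time of [j.+1 ^ 2], Chebyshev bounds a relative deviation of [1 / (i + 1)] by
    [B * (i + 1)^2 / (j + 1)^2], summable in [j]. Taking all [i] at once leaves a single null
    set. *)
Lemma crp_K_ae :
  {ae P, forall x, asym_equiv (fun t => crp_K R Pi t x) E}.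
Proof.
have E0 : E 0%N = 0 by exact: law_mean0.
have B0 : 0 <= B%:R :> R by [].
have E_homo := @law_mean_homo R n p p_ge0.
have E_step t : E t.+1 <= E t + B%:R.
  by rewrite law_meanS lerD2l; exact: step_mean_le.
pose tau := hitting E_infty.
pose F i j := [set x | i.+1%:R^-1 * E (tau j.+1) <=
  `|crp_K R Pi (tau j.+1) x - E (tau j.+1)|].
have F_ae : {ae P, forall x, forall i, exists J, forall j, (J <= j)%N -> ~ F i j x}.
  apply: ae_foralln => i.
  apply: (@borel_cantelli_sqr _ _ _ P (F i) (B%:R * i.+1%:R ^+ 2)) => j.
    exact: (measurable_cycle crpPi (tau j.+1)
      (fun k => i.+1%:R^-1 * E (tau j.+1) <= `|k%:R - E (tau j.+1)|)).
  have Etau : j.+1%:R ^+ 2 <= E (tau j.+1) := hitting_ge E_infty j.+1.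
  have Etau0 : 0 < E (tau j.+1) by apply: lt_le_trans Etau; rewrite exprn_gt0.
  apply: le_trans (crp_chebyshev _ _) _; first by rewrite mulr_gt0// invr_gt0.
  rewrite lee_fin exprMn invfM !exprVn invrK.
  apply: (@le_trans _ _ (B%:R * E (tau j.+1) * (i.+1%:R ^+ 2 * (E (tau j.+1) ^+ 2)^-1))).
    rewrite ler_wpM2r ?mulr_ge0 ?invr_ge0 ?sqr_ge0//.
    exact: law_var_le_mean.
  have -> : B%:R * E (tau j.+1) * (i.+1%:R ^+ 2 * (E (tau j.+1) ^+ 2)^-1) =
      B%:R * i.+1%:R ^+ 2 * (E (tau j.+1))^-1 by field; rewrite gt_eqF.
  rewrite ler_wpM2l ?mulr_ge0 ?sqr_ge0// lef_pV2 ?posrE ?exprn_gt0//.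
apply: filterS2 F_ae (num_cycles_ae_monotone crpPi) => x Fx Kx.
apply: (subsequence_ratio E0 B0 E_homo E_step (E_infty := E_infty)).
  by apply: homo_leq => // [y z w|t]; [exact: le_trans|rewrite /crp_K ler_nat].
(* With this [i] the precision [1 / (i + 1)] is below [e]; the index is then shifted because [F i j]
   concerns [tau j.+1]. *)
move=> e e0; have [J JF] := Fx (Num.truncn e^-1).
exists J.+1 => -[//|j] Jj; rewrite leNgt; apply/negP => h.
apply: (JF j Jj); rewrite /F /=; apply: le_trans (ltW h).
have Etau : 0 <= E (tau j.+1).
  by apply: le_trans (hitting_ge E_infty j.+1); rewrite sqr_ge0.
rewrite ler_wpM2r// -[leRHS]invrK lef_pV2 ?posrE ?invr_gt0//.
by rewrite ltW// truncnS_gt.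
Qed.

Lemma crp_K_clt : cvg_in_distribution P
  (fun t x => (crp_K R Pi t x - E t) / Num.sqrt (V t)) (normal_prob 0 1).
Proof.
move=> x _.
have -> : (fun t => P [set z | (crp_K R Pi t z - E t) / Num.sqrt (V t) <= x]) =
    EFin \o (fun t => sum_law n p t
      (fun j => ((j%:R - E t) / Num.sqrt (V t) <= x)%R%:R)).
  apply/funext => t; rewrite /= -cycle_lawE.
  exact: (cycle_probability crpPi t (fun j => (j%:R - E t) / Num.sqrt (V t) <= x)).
rewrite PhiE; apply: cvg_EFin; first exact: nearW.
exact: (sum_law_clt p_ge0 p_sum m_le V_infty).
Qed.

End bounded.

End crp_asymptotics.

Theorem theorem3 (R : realType) (d : measure_display) (T : measurableType d)
    (P : probability T R) (n : nat -> nat) (theta : R)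
    (Pi : nat -> T -> seq nat)
    (n_ge1 : forall i, (1 <= i)%N -> (1 <= n i)%N)
    (theta_gt0 : 0 < theta)
    (crpPi : is_multiset_crp P n theta Pi) :
  let K : nat -> T -> R := crp_K R Pi in
  let EK : nat -> R := fun t => mean P (K t) in
  let VK : nat -> R := fun t => var P (K t) in
  let log : nat -> R := fun t => ln t%:R in
  (theta = 1 ->
   (exists m : nat, (1 <= m)%N /\ forall i, (1 <= i)%N -> n i = m) ->
     asym_equiv EK log /\ asym_equiv VK log)
  /\
  ((exists B : nat, forall i, (1 <= i)%N -> (n i <= B)%N) ->
     [/\ asym_order EK log,
         asym_order VK log,
         {ae P, forall x, asym_equiv (fun t => K t x) EK}
       & cvg_in_distribution P
           (fun t x => (K t x - EK t) / Num.sqrt (VK t))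
           (normal_prob 0 1)]).
Proof.
move=> K EK VK log.
have EKE : EK = law_mean n (step_mass n theta).
  by apply/funext => t; exact: mean_crp_K.
have VKE : VK = law_var n (step_mass n theta).
  by apply/funext => t; exact: var_crp_K.
rewrite EKE VKE; split.
  move=> theta1 [m [m1 nm]].
  have n_le i : (1 <= i)%N -> (n i <= m)%N by move=> /nm ->.
  have msizeE t : msize n t = (m * t)%N.
    elim: t => [|t IH]; first by rewrite /msize big_geq// muln0.
    by rewrite /msize big_nat_recr//= -/(msize n t) IH nm// mulnS addnC.
  (* For a constant sequence and [theta = 1] the rate is exactly [1 / t], so the lower and upper
     logarithmic constants are both 1. *)
  have rate t : (0 < t)%N ->
      (1 : R) / t%:R <= step_rate n theta t.+1 <= (1 : R) / t%:R.
    move=> t0; rewrite /step_rate theta1 /= msizeE nm//.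
    have -> : 1 * m%:R / (m * t)%:R = 1 / t%:R :> R.
      by rewrite natrM; field; rewrite !pnatr_eq0 -!lt0n m1 t0.
    by rewrite lexx.
  have [D DP] := law_log_bounds n_ge1 theta_gt0 n_le ler01 rate.
  by split; apply: (@asym_equiv_ln _ _ D) => t /DP[].
move=> [B n_le]; have [Eo Vo] := law_order n_ge1 theta_gt0 n_le.
split => //.
- exact: (crp_K_ae n_ge1 theta_gt0 crpPi n_le).
- exact: (crp_K_clt n_ge1 theta_gt0 crpPi n_le).
Qed.
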